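(* There exists an invertible continuous linear operator $T$ on $\ell^1(\mathbb{N})$ such that $T$ is frequently hypercyclic and $T^{-1}$ is not frequently hypercyclic.
   Context: $\mathbb{N}=\{0,1,2,\dots\}$ and $\ell^1(\mathbb{N})$ is the Banach space of absolutely summable (complex) sequences. For a set $A\subset\mathbb{N}$, its lower density is $\underline{\mathrm{dens}}(A)=\liminf_{N\to\infty}\frac{\#(A\cap[0,N])}{N+1}$. A continuous linear operator $T$ on a separable infinite-dimensional Banach space $X$ is frequently hypercyclic if there exists $x\in X$ such that for every non-empty open set $U\subset X$, the set $N_T(x,U)=\{n\ge 0: T^n x\in U\}$ satisfies $\underline{\mathrm{dens}}(N_T(x,U))>0$. *)

(* Defs.v *)
From HB Require Import structures.
From mathcomp Require Import all_boot all_order all_algebra.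
From mathcomp Require Import all_classical all_reals topology normedtype.
From mathcomp Require Import sequences.
From mathcomp Require Import complex.

Set Implicit Arguments.
Unset Strict Implicit.
Unset Printing Implicit Defensive.

Import Order.TTheory GRing.Theory Num.Theory.
Import numFieldNormedType.Exports.
Import ComplexField.Normc.

Local Open Scope classical_set_scope.
Local Open Scope ring_scope.

Section l1_space.
Context {R : realType}.

Definition abs_summable : {pred nat -> R[i]} :=
  fun x => `[< cvgn (series (fun n => normc (x n))) >].

Lemma abs_summableP (x : nat -> R[i]) :
  reflect (cvgn (series (fun n => normc (x n)))) (x \in abs_summable).
Proof. exact: asboolP. Qed.

Lemma normc_ge0 (z : R[i]) : 0 <= normc z.
Proof. by case: z => a b; exact: sqrtr_ge0. Qed.

Lemma abs_summable_submod_closed : submod_closed abs_summable.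
Proof.
split=> [|a x y /abs_summableP cx /abs_summableP cy]; apply/abs_summableP.
  rewrite (_ : (fun n => _) = 0); last by apply/funext => n; exact: normc0.
  by rewrite (_ : series 0 = 0);
    [exact: is_cvg_cst|apply/funext => n; exact: big1].
apply: (@series_le_cvg _ _
  (fun n => normc a * normc (x n) + normc (y n))) => [n|n|n|].
- exact: normc_ge0.
- by rewrite addr_ge0 ?mulr_ge0 ?normc_ge0.
- by rewrite -normcM; exact: le_normcD.
- have := is_cvg_seriesD (is_cvg_seriesZ (k := normc a) cx) cy.
  exact.
Qed.

HB.instance Definition _ :=
  GRing.isSubmodClosed.Build R[i] (nat -> R[i]) abs_summable
    abs_summable_submod_closed.

End l1_space.

Record l1 (R : realType) := L1 {
  l1_val :> nat -> R[i] ;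
  l1P : l1_val \in abs_summable
}.

HB.instance Definition _ (R : realType) := [isSub for @l1_val R].
HB.instance Definition _ (R : realType) := [Choice of l1 R by <:].
HB.instance Definition _ (R : realType) :=
  [SubChoice_isSubLmodule of l1 R by <:].

Section l1_norm.
Context {R : realType}.
Implicit Types x y : l1 R.

Lemma l1_summable x : cvgn (series (fun n => normc (x n))).
Proof. exact/abs_summableP/l1P. Qed.

(* `Lmodule_isNormed` wants a norm with values in the scalar field R[i]. *)
Definition l1_norm x : R[i] := (limn (series (fun n => normc (x n))))%:C%C.

Lemma ler_l1_normD x y : l1_norm (x + y) <= l1_norm x + l1_norm y.
Proof.
rewrite -rmorphD/= lecR -lim_seriesD; [|exact: l1_summable..].
apply: lim_series_le; [exact: l1_summable| |move=> n; exact: le_normcD].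
exact: is_cvg_seriesD (@l1_summable x) (@l1_summable y).
Qed.

Lemma l1_normZ (a : R[i]) x : l1_norm (a *: x) = `|a| * l1_norm x.
Proof.
rewrite -[`|a|]/((normc a)%:C%C) -rmorphM/=; congr (_%:C)%C.
rewrite -[RHS](lim_seriesZ (normc a) (@l1_summable x)).
by congr (limn (series _)); apply/funext => n; exact: normcM.
Qed.

Lemma l1_norm0_eq0 x : l1_norm x = 0 -> x = 0.
Proof.
move=> [x0]; apply/val_inj/funext => n; apply: eq0_normc.
apply/eqP; rewrite eq_le normc_ge0 andbT -x0.
have nd : nondecreasing_seq (series (fun n => normc (x n))).
  by apply: nondecreasing_series => k _ _; exact: normc_ge0.
apply: le_trans (nondecreasing_cvgn_le nd (@l1_summable x) n.+1).
by rewrite seriesEnat/= big_nat_recr//= lerDr sumr_ge0// => k _;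
  exact: normc_ge0.
Qed.

End l1_norm.

HB.instance Definition _ (R : realType) := Lmodule_isNormed.Build R[i] (l1 R)
  ler_l1_normD l1_normZ l1_norm0_eq0.

Section l1_complete.
Context {R : realType}.
Implicit Types x y : l1 R.

Lemma l1_normE x : `|x| = l1_norm x. Proof. by []. Qed.

Lemma series_normc_le x N (e : R) :
  `|x| <= e%:C%C -> \sum_(0 <= n < N) normc (x n) <= e.
Proof.
rewrite l1_normE lecR; apply: le_trans.
have nd : nondecreasing_seq (series (fun n => normc (x n))).
  by apply: nondecreasing_series => k _ _; exact: normc_ge0.
exact: nondecreasing_cvgn_le nd (@l1_summable R x) N.
Qed.

Lemma normc_coord_le x n (e : R) : `|x| <= e%:C%C -> normc (x n) <= e.
Proof.
move=> /(@series_normc_le _ n.+1); apply: le_trans.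
by rewrite big_nat_recr//= lerDr sumr_ge0// => k _; exact: normc_ge0.
Qed.

Lemma Re_le_normc (z : R[i]) : `|complex.Re z| <= normc z.
Proof. by have := normc_ge_Re z; rewrite lecR. Qed.

Lemma Im_le_normc (z : R[i]) : `|complex.Im z| <= normc z.
Proof.
case: z => a b /=; rewrite -sqrtr_sqr ler_sqrt ?addr_ge0 ?sqr_ge0//.
by rewrite lerDr sqr_ge0.
Qed.

Lemma normc_le_ReIm (z : R[i]) :
  normc z <= `|complex.Re z| + `|complex.Im z|.
Proof.
case: z => a b /=; rewrite -[leRHS]ger0_norm ?addr_ge0// -sqrtr_sqr.
rewrite ler_sqrt ?sqr_ge0// sqrrD !real_normK ?num_real//.
by rewrite -addrA lerD2l lerDr mulrn_wge0 ?mulr_ge0.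
Qed.

Lemma coord_cvg (F : set_system (l1 R)) (f : l1 R -> R) :
  ProperFilter F -> cauchy F ->
  (forall x y (e : R), `|x - y| <= e%:C%C -> `|f x - f y| <= e) ->
  cvg (f @ F).
Proof.
move=> FF /cauchyP Fc flip; apply: cauchy_cvg; apply: cauchy_exP => e e0.
have [x Fx] := Fc (e / 2)%:C%C ltac:(by rewrite ltcR divr_gt0).
exists (f x); change (F (f @^-1` ball (f x) e)).
apply: filterS Fx => y; rewrite /preimage/= -!ball_normE/= => /ltW xy.
by apply: le_lt_trans (flip _ _ _ xy) _; rewrite ltr_pdivrMr// ltr_pMr// ltr1n.
Qed.

Lemma l1_complete (F : set_system (l1 R)) :
  ProperFilter F -> cauchy F -> cvg F.
Proof.
move=> FF Fc.
have reF n : cvg ((fun x : l1 R => complex.Re (x n)) @ F).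
  apply: coord_cvg => // x y e /(normc_coord_le n); apply: le_trans.
  by rewrite -raddfB; exact: Re_le_normc.
have imF n : cvg ((fun x : l1 R => complex.Im (x n)) @ F).
  apply: coord_cvg => // x y e /(normc_coord_le n); apply: le_trans.
  by rewrite -raddfB; exact: Im_le_normc.
pose l n : R[i] := Complex (lim ((fun x : l1 R => complex.Re (x n)) @ F))
                           (lim ((fun x : l1 R => complex.Im (x n)) @ F)).
have lF n (d : R) : 0 < d -> \forall x \near F, normc (l n - (x : l1 R) n) <= d.
  move=> d0; have d20 : 0 < d / 2 by rewrite divr_gt0.
  have /cvgrPdist_le/(_ _ d20) reFn := reF n.
  have /cvgrPdist_le/(_ _ d20) imFn := imF n.
  apply: filterS2 reFn imFn => x xre xim; apply: le_trans (normc_le_ReIm _) _.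
  by rewrite [d]splitr !raddfB lerD.
have lsum N (d : R) : 0 < d ->
    \forall x \near F, \sum_(0 <= n < N) normc (l n - (x : l1 R) n) <= d *+ N.
  move=> d0; elim: N => [|N IH]; first by near=> x; rewrite big_nil.
  apply: filterS2 IH (lF N _ d0) => x xN xd.
  by rewrite big_nat_recr//= mulrSr lerD.
have bnd x0 (e : R) : F (ball x0 e%:C%C) ->
    forall N, \sum_(0 <= n < N) normc (l n - x0 n) <= e.
  move=> Fx0 N; apply/ler_addgt0Pr => d d0.
  have dN0 : 0 < d / N.+1%:R by rewrite divr_gt0.
  have [x [xx0 xN]] := filter_ex (filterI Fx0 (lsum N _ dN0)).
  have {}xx0 : \sum_(0 <= n < N) normc ((x - x0) n) <= e.
    by apply/series_normc_le/ltW; move: xx0; rewrite -ball_normE/= distrC.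
  have {}xN : \sum_(0 <= n < N) normc (l n - x n) <= d.
    apply: le_trans xN _; rewrite -[leLHS]mulr_natr mulrAC ler_pdivrMr//.
    by rewrite ler_pM2l// ler_nat.
  apply: le_trans (lerD xx0 xN); rewrite -big_split/=; apply: ler_sum => n _.
  rewrite addrC; apply: le_trans (le_normcD _ _).
  by rewrite [X in _ <= normc X]addrA subrK.
have summ x0 (e : R) : F (ball x0 e%:C%C) ->
    cvgn (series (fun n => normc (l n - x0 n))).
  move=> /bnd xe; apply: nondecreasing_is_cvgn.
    by apply: nondecreasing_series => k _ _; exact: normc_ge0.
  by exists e => _ [N _ <-]; exact: xe.
have /cauchyP Fce := Fc.
have [x1 Fx1] := Fce 1%:C%C ltac:(by rewrite ltcR).
have lP : l \in abs_summable.
  have /abs_summableP h := summ _ _ Fx1.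
  have -> : l = (fun n => l n - x1 n) + x1.
    by apply/funext => n; rewrite /= fctE subrK.
  by rewrite rpredD//; exact: l1P.
apply/cvg_ex; exists (L1 lP); apply/cvgrPdist_le => e.
have -> : (0 < e) = (0 < complex.Re e) && (e == (complex.Re e)%:C%C).
  by case: e => a b; rewrite ltcE eq_complex/= eqxx/= andbC.
case/andP; set r := complex.Re e => r0 /eqP ->.
have [x0 Fx0] := Fce (r / 2)%:C%C ltac:(by rewrite ltcR divr_gt0).
have Lx0 : `|L1 lP - x0| <= (r / 2)%:C%C.
  rewrite l1_normE lecR; apply: limr_le; first exact: summ Fx0.
  by apply: nearW => N; exact: bnd Fx0 N.
apply: filterS Fx0 => x; rewrite -ball_normE/= => /ltW x0x.
rewrite [r]splitr rmorphD/= -(subrK x0 (L1 lP)) -addrA.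
by apply: le_trans (ler_normD _ _) _; exact: lerD.
Unshelve. all: by end_near. Qed.

End l1_complete.

HB.instance Definition _ (R : realType) :=
  Uniform_isComplete.Build (l1 R) l1_complete.

Definition lower_density (R : realType) (A : set nat) : \bar R :=
  limn_einf (fun N =>
    ((#|[set n : 'I_N.+1 | (n : nat) \in A]%SET|)%:R / N.+1%:R : R)%:E).

Definition return_set (X : Type) (T : X -> X) (x : X) (U : set X) : set nat :=
  [set n | U (iter n T x)].

Definition frequently_hypercyclic (R : realType) (X : completeNormedModType R[i])
    (T : X -> X) : Prop :=
  exists x : X, forall U : set X, open U -> U !=set0 ->
    (0 < lower_density R (return_set T x U))%E.

(* Main.v *)
(* Re-index the canonical basis of l1 by blocks (n, j), n in N, j in Z, and let
   [f n j] be the basis vector of block n and position j, scaled by a weight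
   2 ^ exponent n j.  Write L_n = 8 qq n, so that L_(n-1) = 4 qq n.  The vectors
     g n j = f n j - [L_(n-1) <= j] f (n-1) j + [L_(n-1) <= j < L_n] zeta
   with zeta = T^s z, z being a target vector (a combination of vectors g of
   blocks < l) attached to the type l of block n, and s being reset
   periodically, span a dense subspace.  The operator T shifts them:
   T (g n j) = g n (j + 1); it is bounded both ways because the weight is large
   wherever f n j -> f n (j + 1) is perturbed.

   Forward orbit.  For x = \sum_n f n 0 and L_(n-1) <= t < L_n the sum
   \sum_n g n t telescopes to T^t x = \sum_(k >= n) f k t + zeta: block n erases
   block n - 1 and displays its target at regularly spaced times, at which all
   the weights involved are small.  As L_n / L_(n-1) = 2 and every type recurs
   with bounded gaps, every target is approached with positive lower density.

   Backward orbit.  Within time L_m the part of x carried by the positions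
   j < L_m of block m leaves through j < 0, where the weight is 2 ^ beta m.  Only
   blocks whose type is > m can cancel it, when they cross a reset of s, and
   such resets are followed by guards, stretches of large weight longer than
   2 ^ m * L_m: the mass available for a cancellation in due time is
   negligible, so that T^(-t) x is large for 2 L_m <= t <= 2 ^ m * L_m.  If this
   happens for infinitely many m, then T^(-t) x visits the unit ball with lower
   density 0; otherwise the coordinate (0, 0) of T^(-t) x stays bounded and
   the orbit is not even dense. *)

From HB Require Import structures.
Require Import Defs.
From mathcomp Require Import all_boot all_order all_algebra.
From mathcomp Require Import all_classical all_reals topology normedtype.
From mathcomp Require Import ereal sequences complex.
From mathcomp Require Import zify ring lra.

Set Implicit Arguments.
Unset Strict Implicit.
Unset Printing Implicit Defensive.

Import Order.TTheory GRing.Theory Num.Theory.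
Import numFieldNormedType.Exports.
Import ComplexField.Normc.

Local Open Scope classical_set_scope.
Local Open Scope ring_scope.

(** * Series and operators on l1 *)

Lemma sum_ord_split (V : zmodType) (u : nat -> V) (K0 K : nat) : (K0 <= K)%N ->
  \sum_(k < K) u k = \sum_(k < K0) u k + \sum_(K0 <= k < K) u k.
Proof. by move=> K0K; rewrite -[LHS](big_mkord xpredT) (big_cat_nat _ K0K)//= big_mkord. Qed.

Section l1_extra.
Context {R : realType}.
Implicit Types (x y : l1 R) (u v : nat -> l1 R).

(** The norm of [l1 R] is valued in [R[i]]; this real version keeps estimates in a totally ordered
    field. *)
Definition nm x : R := limn (series (fun n => normc (x n))).

Lemma l1_norm_nm x : `|x| = (nm x)%:C%C. Proof. by []. Qed.

Lemma l1_coordD x y k : (x + y) k = x k + y k. Proof. by []. Qed.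
Lemma l1_coordN x k : (- x) k = - x k. Proof. by []. Qed.
Lemma l1_coordB x y k : (x - y) k = x k - y k. Proof. by []. Qed.
Lemma l1_coordZ (a : R[i]) x k : (a *: x) k = a * x k. Proof. by []. Qed.
Lemma l1_coord0 k : (0 : l1 R) k = 0. Proof. by []. Qed.

Lemma l1_coord_sum (I : Type) (r : seq I) (P : pred I) (f : I -> l1 R) k :
  (\sum_(i <- r | P i) f i) k = \sum_(i <- r | P i) f i k.
Proof. exact: (big_morph (fun x : l1 R => x k) (fun x y => l1_coordD x y k) (l1_coord0 k)). Qed.

Lemma nm_le x (c : R) : (nm x <= c) = (`|x| <= c%:C%C).
Proof. by rewrite l1_norm_nm lecR. Qed.

Lemma nm_partial x K : \sum_(0 <= k < K) normc (x k) <= nm x.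
Proof. by apply: series_normc_le; rewrite -nm_le. Qed.

Lemma nm_ge0 x : 0 <= nm x.
Proof. by apply: le_trans (nm_partial x 0); rewrite big_nil. Qed.

Lemma nm_coord x k : normc (x k) <= nm x.
Proof. by apply: normc_coord_le; rewrite -nm_le. Qed.

Lemma nm_leP x (c : R) : (forall K, \sum_(0 <= k < K) normc (x k) <= c) -> nm x <= c.
Proof.
by move=> xc; apply: limr_le; [exact: l1_summable|apply: nearW => K; exact: xc].
Qed.

Lemma nmD x y : nm (x + y) <= nm x + nm y.
Proof. by rewrite nm_le rmorphD/= -!l1_norm_nm ler_normD. Qed.

Lemma nmN x : nm (- x) = nm x.
Proof. by apply/complexI; rewrite -!l1_norm_nm normrN. Qed.

Lemma nmB x y : nm (x - y) <= nm x + nm y.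
Proof. by rewrite -(nmN y) nmD. Qed.

Lemma nmC x y : nm (x - y) = nm (y - x).
Proof. by rewrite -nmN opprB. Qed.

Lemma nm0 : nm 0 = 0.
Proof. by apply/complexI; rewrite -l1_norm_nm normr0. Qed.

Lemma nmZ (a : R[i]) x : nm (a *: x) = normc a * nm x.
Proof. by apply/complexI; rewrite -l1_norm_nm normrZ rmorphM. Qed.

Lemma nm_eq0 x : nm x = 0 -> x = 0.
Proof. by move=> x0; apply/eqP; rewrite -normr_eq0 l1_norm_nm x0. Qed.

Lemma nm_triangle z x y : nm (x - y) <= nm (x - z) + nm (z - y).
Proof. by apply: le_trans (nmD _ _); rewrite addrA subrK. Qed.

Lemma nm_sum (I : Type) (r : seq I) (P : pred I) (f : I -> l1 R) :
  nm (\sum_(i <- r | P i) f i) <= \sum_(i <- r | P i) nm (f i).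
Proof.
elim/big_rec2 : _ => [|i c x _ xc]; first by rewrite nm0.
by apply: le_trans (nmD _ _) _; rewrite lerD2l.
Qed.

Lemma finite_support_summable (f : nat -> R[i]) K :
  (forall k, (K <= k)%N -> f k = 0) -> f \in abs_summable.
Proof.
move=> f0; apply/abs_summableP.
apply: nondecreasing_is_cvgn.
  by apply: nondecreasing_series => k _ _; exact: normc_ge0.
exists (\sum_(0 <= k < K) normc (f k)) => _ [n _ <-].
rewrite seriesEnat/=; have [nK|Kn] := leqP n K.
  by rewrite [leRHS](big_cat_nat _ nK)//= lerDl sumr_ge0// => k _; exact: normc_ge0.
rewrite (big_cat_nat _ (ltnW Kn))//= [X in _ + X]big_nat_cond.
rewrite [X in _ + X]big1 ?addr0// => k /andP[/andP[Kk _] _].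
by rewrite f0// normc0.
Qed.

Lemma ee_summable (k : nat) : (fun i => (i == k)%:R : R[i]) \in abs_summable.
Proof. by apply: (@finite_support_summable _ k.+1) => i ki; rewrite gtn_eqF. Qed.

Definition ee k : l1 R := L1 (ee_summable k).

Lemma eeE k i : ee k i = (i == k)%:R. Proof. by []. Qed.

Lemma normc_nat (b : bool) : normc (b%:R : R[i]) = b%:R.
Proof. by case: b; rewrite ?normc0 ?normc1. Qed.

Lemma nm_ee k : nm (ee k) = 1.
Proof.
apply/le_anti/andP; split; last first.
  by apply: le_trans (nm_coord _ k); rewrite eeE eqxx normc1.
apply: nm_leP => K.
rewrite (eq_bigr (fun i => if i == k then 1 else 0)); last first.
  by move=> i _; rewrite eeE normc_nat; case: eqP.
by rewrite -big_mkcond/= big_nat1_eq; case: ifP.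
Qed.

Lemma nondecreasing_bounded_tail (s : nat -> R) (C : R) :
  {homo s : m n / (m <= n)%N >-> m <= n} -> (forall n, s n <= C) ->
  forall e, 0 < e -> exists K0, forall K, (K0 <= K)%N -> s K <= s K0 + e.
Proof.
move=> snd sC e e0.
have /cvgrPdist_le/(_ _ e0)[K0 _ sK0] : s @ \oo --> limn s.
  by apply: nondecreasing_is_cvgn => //; exists C => _ [n _ <-].
exists K0 => K K0K.
have sl : s K <= limn s.
  apply: nondecreasing_cvgn_le => //.
  by apply: nondecreasing_is_cvgn => //; exists C => _ [n _ <-].
have := sK0 K0 (leqnn _); rewrite /= ler_norml => /andP[_].
by rewrite lerBlDr addrC => /(le_trans sl).
Qed.

Definition conv u y := forall e, 0 < e ->
  exists K0, forall K, (K0 <= K)%N -> nm (y - u K) <= e.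

Lemma conv_ub u y z (c : R) K1 : conv u y ->
  (forall K, (K1 <= K)%N -> nm (u K - z) <= c) -> nm (y - z) <= c.
Proof.
move=> uy uz; apply/ler_addgt0Pl => e e0.
have [K0 K0P] := uy _ e0.
apply: le_trans (nm_triangle (u (maxn K0 K1)) _ _) _.
by apply: lerD; [apply: K0P; exact: leq_maxl|apply: uz; exact: leq_maxr].
Qed.

Lemma convD u v y z : conv u y -> conv v z -> conv (fun k => u k + v k) (y + z).
Proof.
move=> uy vz e e0; have e20 : 0 < e / 2 by rewrite divr_gt0.
have [K0 K0P] := uy _ e20; have [K1 K1P] := vz _ e20.
exists (maxn K0 K1) => K; rewrite geq_max => /andP[K0K K1K].
rewrite opprD addrACA [e]splitr; apply: le_trans (nmD _ _) _.
by apply: lerD; [exact: K0P|exact: K1P].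
Qed.

Lemma conv_lipschitz u y (f : l1 R -> l1 R) (C : R) :
  (forall x z, nm (f x - f z) <= C * nm (x - z)) -> conv u y ->
  conv (f \o u) (f y).
Proof.
move=> fC uy e e0; have C0 : 0 < `|C| + 1 by rewrite ltr_wpDl.
have [K0 K0P] := uy _ (divr_gt0 e0 C0); exists K0 => K /K0P; rewrite ler_pdivlMr// => h.
apply: le_trans (fC _ _) _; apply: le_trans h; rewrite mulrC ler_wpM2l ?nm_ge0//.
by apply: le_trans (ler_norm _) _; rewrite lerDl.
Qed.

Lemma conv_unique u y z : conv u y -> conv u z -> y = z.
Proof.
move=> uy uz; apply/eqP; rewrite -subr_eq0; apply/eqP/nm_eq0/le_anti.
rewrite nm_ge0 andbT; apply/ler_addgt0Pl => e e0; rewrite addr0.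
have [K0 K0P] := uz _ e0; apply: (conv_ub uy (K1 := K0)) => K K0K.
by rewrite nmC; exact: K0P K0K.
Qed.

Lemma conv_le u y (c : R) : conv u y -> (forall K, nm (u K) <= c) -> nm y <= c.
Proof.
move=> uy uc; rewrite -[y]subr0; apply: (conv_ub uy (K1 := 0%N)) => K _.
by rewrite subr0.
Qed.

Lemma cauchy_conv u :
  (forall e, 0 < e -> exists K0, forall K, (K0 <= K)%N -> nm (u K - u K0) <= e) ->
  exists y, conv u y.
Proof.
move=> uc; have /cvg_ex[y uy] : cvg (u @ \oo).
  apply: cauchy_cvg; apply: cauchy_exP => e e0.
  have eE : e = (complex.Re e)%:C%C.
    by move: e0; case: e => a b; rewrite ltcE/= => /andP[/eqP-> _].
  have r0 : 0 < complex.Re e by move: e0; rewrite {1}eE ltcR.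
  have [K0 K0P] := uc _ (divr_gt0 r0 (@ltr0n _ 2)).
  exists (u K0); exists K0 => // K /K0P h.
  rewrite /= -ball_normE/= distrC l1_norm_nm eE ltcR.
  by apply: le_lt_trans h _; rewrite ltr_pdivrMr// ltr_pMr// ltr1n.
exists y => e e0.
have /cvgrPdist_le : u @ \oo --> y by exact: uy.
have e0' : 0 < e%:C%C :> R[i] by rewrite ltcR.
move=> /(_ _ e0')[K0 _ K0P]; exists K0 => K /K0P.
by rewrite /= l1_norm_nm lecR.
Qed.

Lemma sum_conv u (C : R) : (forall K, \sum_(k < K) nm (u k) <= C) ->
  exists y, conv (fun K => \sum_(k < K) u k) y.
Proof.
move=> uC; apply: cauchy_conv => e e0.
have [|K0 K0P] := @nondecreasing_bounded_tail (fun K => \sum_(k < K) nm (u k)) C _ uC e e0.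
  apply/nondecreasing_seqP => n; rewrite big_ord_recr/= lerDl; exact: nm_ge0.
exists K0 => K K0K; have := K0P _ K0K.
rewrite (sum_ord_split (fun k => nm (u k)) K0K) lerD2l.
rewrite (sum_ord_split u K0K) addrAC subrr add0r.
by apply: le_trans; exact: nm_sum.
Qed.

Definition trunc x K : l1 R := \sum_(k < K) x k *: ee k.

Lemma truncE x K i : trunc x K i = if (i < K)%N then x i else 0.
Proof.
rewrite /trunc l1_coord_sum.
under eq_bigr do rewrite l1_coordZ eeE.
case: ltnP => iK; last first.
  by rewrite big1// => k _; rewrite gtn_eqF ?mulr0// (leq_trans (ltn_ord k)).
rewrite (bigD1 (Ordinal iK))//= eqxx mulr1 big1 ?addr0// => k /eqP ki.
by case: eqP => [ik|]; rewrite ?mulr0//; case: ki; exact/val_inj.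
Qed.

Lemma nm_trunc x K : nm (trunc x K) = \sum_(k < K) normc (x k).
Proof.
apply/le_anti/andP; split.
  apply: le_trans (nm_sum _ _ _) _; apply: ler_sum => k _.
  by rewrite nmZ nm_ee mulr1.
apply: le_trans (nm_partial _ K); rewrite big_mkord.
by apply: ler_sum => k _; rewrite truncE ltn_ord.
Qed.

Lemma trunc_conv x : conv (trunc x) x.
Proof.
move=> e e0.
have [||K0 K0P] := @nondecreasing_bounded_tail
    (fun K => \sum_(k < K) normc (x k)) (nm x) _ _ e e0.
- by apply/nondecreasing_seqP => n; rewrite big_ord_recr/= lerDl; exact: normc_ge0.
- by move=> n; rewrite -(big_mkord xpredT (fun k => normc (x k))); exact: nm_partial.
have K0t K : \sum_(K0 <= k < K) normc (x k) <= e.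
  have [KK0|K0K] := leqP K K0; first by rewrite big_geq// ltW.
  have := K0P _ (ltnW K0K).
  by rewrite (sum_ord_split (fun k => normc (x k)) (ltnW K0K)) lerD2l.
exists K0 => K K0K; apply: nm_leP => M.
rewrite (eq_bigr (fun k => if (K <= k)%N then normc (x k) else 0)); last first.
  move=> k _; rewrite l1_coordB truncE ltnNge; case: leqP; rewrite ?subr0//.
  by rewrite subrr normc0.
rewrite -big_mkcond/=; apply: le_trans (K0t M).
rewrite [leLHS]big_mkcond/= (@big_nat_widenl _ _ _ K0 0%N)//= [leRHS]big_mkcond/=.
apply: ler_sum => k _; case: leqP => Kk; first by rewrite (leq_trans K0K Kk).
by case: ifP => // _; exact: normc_ge0.
Qed.

(** Universal property of the canonical basis of l1: for bounded [v k] the series of the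
    [x k *: v k] converges absolutely. *)
Lemma operator_exists (v : nat -> l1 R) (C : R) : (forall k, nm (v k) <= C) ->
  exists Phi : {linear l1 R -> l1 R},
    (forall k, Phi (ee k) = v k) /\ forall x, nm (Phi x) <= C * nm x.
Proof.
move=> vC.
have C0 : 0 <= C by apply: le_trans (vC 0%N); exact: nm_ge0.
pose s x K := \sum_(k < K) x k *: v k.
have sC x K : \sum_(k < K) nm (x k *: v k) <= C * nm x.
  apply: (@le_trans _ _ (\sum_(k < K) C * normc (x k))).
    by apply: ler_sum => k _; rewrite nmZ mulrC ler_wpM2r ?normc_ge0.
  rewrite -mulr_sumr ler_wpM2l// -nm_trunc nm_trunc.
  by rewrite -(big_mkord xpredT (fun k => normc (x k))) nm_partial.
have /choice[f fP] x : exists y, conv (s x) y.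
  exact: (sum_conv (u := fun k => x k *: v k) (sC x)).
have flin : linear f.
  move=> a x y; apply: conv_unique (fP _) _.
  have -> : s (a *: x + y) = fun K => a *: s x K + s y K.
    apply/funext => K; rewrite /s scaler_sumr -big_split; apply: eq_bigr => k _.
    by rewrite l1_coordD l1_coordZ scalerDl scalerA.
  apply: convD (fP y).
  apply: (conv_lipschitz (f := fun z => a *: z) (C := normc a)) (fP x) => z t.
  by rewrite -scalerBr nmZ.
pose L := GRing.isLinear.Build _ _ _ _ f flin.
pose Phi : {linear l1 R -> l1 R} := HB.pack f L.
exists Phi; split=> [k|x]; rewrite /Phi/=.
  apply: conv_unique (fP _) _ => e e0; exists k.+1 => K kK.
  rewrite /s (bigD1 (Ordinal kK))//= eqxx scale1r big1 ?addr0.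
    by rewrite subrr nm0 ltW.
  move=> i /eqP ik; case: eqP => [/(@val_inj _ _ _ i (Ordinal kK))//|].
  by rewrite scale0r.
by apply: conv_le (fP x) _ => K; apply: le_trans (nm_sum _ _ _) (sC _ _).
Qed.

Lemma bounded_continuous (f : {linear l1 R -> l1 R}) (C : R) :
  (forall x, nm (f x) <= C * nm x) -> continuous f.
Proof.
move=> fC; apply/linear_bounded_continuous/linear_boundedP.
exists `|C|%:C%C; split; first by rewrite realE lecR normr_ge0.
move=> M; rewrite ltcE/= => /andP[/eqP M0 CM] x.
have -> : M = (complex.Re M)%:C%C by move: M0; case: M {CM} => a b /= ->.
rewrite !l1_norm_nm -rmorphM/= lecR; apply: le_trans (fC x) _.
rewrite ler_wpM2r ?nm_ge0//; apply: le_trans (ltW CM); exact: ler_norm.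
Qed.

Lemma bounded_lipschitz (f : {linear l1 R -> l1 R}) (C : R) :
  (forall x, nm (f x) <= C * nm x) ->
  forall x z, nm (f x - f z) <= C * nm (x - z).
Proof. by move=> fC x z; rewrite -linearB. Qed.

Lemma bounded_eq (f g : {linear l1 R -> l1 R}) (C D : R) :
  (forall x, nm (f x) <= C * nm x) -> (forall x, nm (g x) <= D * nm x) ->
  (forall k, f (ee k) = g (ee k)) -> f =1 g.
Proof.
move=> fC gD fg x.
apply: conv_unique (conv_lipschitz (bounded_lipschitz fC) (trunc_conv x)) _.
have -> : f \o trunc x = g \o trunc x.
  apply/funext => K /=; rewrite /trunc !linear_sum/=; apply: eq_bigr => k _.
  by rewrite !linearZ/= fg.
exact: conv_lipschitz (bounded_lipschitz gD) (trunc_conv x).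
Qed.

End l1_extra.

(** * Open sets and lower density *)

Section density.
Context {R : realType}.

Lemma nbhs_nm_ball (U : set (l1 R)) z : open U -> U z ->
  exists2 r : R, 0 < r & forall y, nm (y - z) < r -> U y.
Proof.
move=> oU Uz; have /nbhs_ballP[e /= e0 eU] : nbhs z U by exact: open_nbhs_nbhs.
have eE : e = (complex.Re e)%:C%C.
  by move: e0; case: e {eU} => a b; rewrite ltcE/= => /andP[/eqP-> _].
exists (complex.Re e) => [|y yz]; first by move: e0; rewrite {1}eE ltcR.
by apply: eU; rewrite -ball_normE/= l1_norm_nm eE ltcR nmC.
Qed.

Definition nm_ball (z : l1 R) (r : R) : set (l1 R) := [set y | nm (y - z) < r].

Lemma open_nm_ball z r : open (nm_ball z r).
Proof.
rewrite /nm_ball openE => y /= yr; apply/nbhs_ballP.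
exists (r - nm (y - z))%:C%C => [|t]; first by rewrite /= ltcR subr_gt0.
rewrite -ball_normE/= l1_norm_nm ltcR => ty.
by apply: le_lt_trans (nm_triangle y _ _) _; rewrite -ltrBrDr nmC.
Qed.

Lemma lower_density_gt0P (A : set nat) : (0 < lower_density R A)%E <->
  exists2 e : R, 0 < e & exists N0, forall N, (N0 <= N)%N ->
    e * N.+1%:R <= #|[set n : 'I_N.+1 | (n : nat) \in A]%SET|%:R.
Proof.
rewrite /lower_density limn_einf_lim.
set u := (fun N => _).
have -> : limn (einfs u) = ereal_sup (range (einfs u)).
  by apply/cvg_lim => //; exact: cvg_einfs_sup.
split=> [/ereal_sup_gt[_ [N0 _ <-]] h|[e e0 [N0 N0P]]].
(* A tail infimum is an extended real; if it is infinite, [1] is a lower bound. *)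
- have [e e0 eu] : exists2 e : R, 0 < e & (e%:E <= einfs u N0)%E.
    case E : (einfs u N0) h => [r| |]//; first by rewrite lte_fin => r0; exists r.
    by move=> _; exists 1 => //; rewrite leey.
  exists e => //; exists N0 => N N0N.
  rewrite -ler_pdivlMr// -lee_fin; apply: le_trans eu _.
  by apply: ereal_inf_lbound; exists N.
- apply: (@lt_le_trans _ _ e%:E); first by rewrite lte_fin.
  apply: (@le_trans _ _ (einfs u N0)).
    apply: le_ereal_inf_tmp => _ [N /= N0N <-].
    by rewrite /u lee_fin ler_pdivlMr// N0P.
  by apply: ereal_sup_ubound; exists N0.
Qed.

Lemma count_le (A : set nat) N M : (forall n, (n <= N)%N -> A n -> (n < M)%N) ->
  (#|[set n : 'I_N.+1 | (n : nat) \in A]%SET| <= M)%N.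
Proof.
move=> AM; have [NM|MN] := ltnP N M.
  by apply: leq_trans (max_card _) _; rewrite card_ord.
rewrite -[leqRHS](card_ord M).
apply: leq_trans (subset_leq_card _) (leq_imset_card (widen_ord (leqW MN)) 'I_M).
apply/fintype.subsetP => n; rewrite inE => /set_mem nA.
have nM : (n < M)%N by apply: AM; rewrite // -ltnS.
by apply/imsetP; exists (Ordinal nM) => //; exact/val_inj.
Qed.

Lemma count_ge (A : set nat) N K a p : (0 < p)%N ->
  (forall k, (k < K)%N -> (a + k * p <= N)%N /\ A (a + k * p)%N) ->
  (K <= #|[set n : 'I_N.+1 | (n : nat) \in A]%SET|)%N.
Proof.
move=> p0 AK; pose g (k : 'I_K) : 'I_N.+1 := inord (a + k * p).
have gE k : g k = (a + k * p)%N :> nat by rewrite inordK// ltnS; case: (AK k).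
have gi : injective g.
  move=> k k' /(congr1 (@nat_of_ord _)); rewrite !gE => /addnI/eqP.
  by rewrite eqn_pmul2r// => /eqP/val_inj.
rewrite -{1}(card_ord K) -(card_imset _ gi); apply: subset_leq_card.
apply/fintype.subsetP => _ /imsetP[k _ ->]; rewrite inE gE; apply/mem_set.
by case: (AK k).
Qed.

End density.

(** * The weight exponents *)

Definition qq (n : nat) : nat := (2 ^ (n + 3))%N.
(** Quadratic growth makes the ratio of consecutive top weights [2 ^ (2 * n + 3)], which absorbs
    constants and powers [2 ^ n]. *)
Definition beta (n : nat) : nat := (n.+1 ^ 2)%N.
(** The drop from the top exponent [beta n] to the bottom [- n], hence the length of a slope of
    [block_exponent]. *)
Definition ramp (n : nat) : nat := (beta n + n)%N.
(* The 2-adic valuation takes every value with bounded gaps. *)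
Definition typ (n : nat) : nat := logn 2 n.
(** Says that a guard of the type of [n] fits into the plateau [[4 * qq n, 5 * qq n]], see
    [act_guard]. *)
Definition act (n : nat) : bool := ((typ n).*2 + 3 <= n)%N.
(* Equal to 2 ^ l * L_l, see [guardE]. *)
Definition guard (l : nat) : nat := (2 ^ (l.*2 + 6))%N.
Definition period (l : nat) : nat := (guard l + 4 * l + 4)%N.
(* The middle of the low stretch between two consecutive guards. *)
Definition hit (l : nat) : nat := (guard l + 2 * l + 2)%N.

Definition on (n : nat) (j : int) : bool :=
  [&& act n, (4 * qq n)%:Z <= j & j < (8 * qq n)%:Z].
Definition phase (n : nat) (j : int) : nat :=
  (`|j - (4 * qq n)%:Z| %% period (typ n))%N.

(** Over a period: a plateau [l + 2] on the guard, then a V-shaped dip reaching [- l] at [hit l]. *)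
Definition slot_exponent (l s : nat) : int :=
  l%:Z + 2 - Num.min (Num.max (s%:Z - (guard l)%:Z) 0) ((period l)%:Z - s%:Z).

(* A 1-Lipschitz function with top value beta n exactly on the half-lines
   j <= - ramp n and L_n <= j and on the interval [L_(n-1), 5/4 L_(n-1)]. *)
Definition block_exponent (n : nat) (j : int) : int :=
  (beta n)%:Z -
  Num.min (Num.max (j + (ramp n)%:Z) 0)
    (Num.min (Num.max ((4 * qq n)%:Z - j) (Num.max (j - (5 * qq n)%:Z) 0))
             (Num.max ((8 * qq n)%:Z - j) 0)).

Definition exponent (n : nat) (j : int) : int :=
  Num.max
    (Num.max (if on n j then slot_exponent (typ n) (phase n j) else - n%:Z) (- n%:Z))
    (block_exponent n j).

Lemma qqS n : qq n.+1 = (2 * qq n)%N.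
Proof. by rewrite /qq addSn expnS. Qed.

Lemma qq_gt0 n : (0 < qq n)%N. Proof. by rewrite expn_gt0. Qed.

Lemma leq_qq m n : (m <= n)%N -> (qq m <= qq n)%N.
Proof. by move=> mn; rewrite leq_pexp2l// leq_add2r. Qed.

Lemma betaS n : beta n.+1 = (beta n + 2 * n + 3)%N.
Proof. rewrite /beta; lia. Qed.

Lemma beta_gt n : (n < beta n)%N.
Proof. by elim: n => // n IH; rewrite betaS; lia. Qed.

Lemma ramp_qq n : (2 * ramp n <= qq n)%N.
Proof.
(* The summand [2 * k + 13] exceeds the increment of [ramp], which closes the induction. *)
have H k : (ramp (k + 4) + 2 * k + 13 <= 2 ^ (k + 6))%N.
  elim: k => [|k]; first by [].
  rewrite /ramp addSn betaS [(k.+1 + 6)%N]addSn expnS; lia.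
case: n => [|[|[|[|k]]]]; rewrite /qq //.
have := H k; rewrite [(k + 4)%N]addnC [(k + 6)%N]addnC [(_ + 3)%N]addnC.
rewrite (_ : (3 + k.+4 = (6 + k).+1)%N) ?expnS; last by lia.
rewrite -[k.+4]/(4 + k)%N; lia.
Qed.

Lemma rampS_qq n : (ramp n.+1 <= qq n)%N.
Proof. by have := ramp_qq n.+1; rewrite qqS leq_pmul2l. Qed.

Lemma act_guard n : act n -> (guard (typ n) <= qq n)%N.
Proof. by move=> an; rewrite leq_pexp2l//; move: an; rewrite /act; lia. Qed.

Lemma exponent_ge n (j : int) : - n%:Z <= exponent n j.
Proof. rewrite /exponent /block_exponent; lia. Qed.

Lemma slot_exponent_le l s : (s < period l)%N -> slot_exponent l s <= (l + 2)%:Z.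
Proof. rewrite /slot_exponent; lia. Qed.

Lemma period_gt0 l : (0 < period l)%N. Proof. by rewrite /period; lia. Qed.

Lemma phase_lt n (j : int) : (phase n j < period (typ n))%N.
Proof. by rewrite ltn_mod period_gt0. Qed.

Lemma on_act n (j : int) : on n j -> ((typ n).*2 + 3 <= n)%N.
Proof. by case/and3P. Qed.

Lemma exponent_le n (j : int) : exponent n j <= (beta n)%:Z.
Proof.
rewrite /exponent /block_exponent; case: ifPn => [/on_act an|_].
  have := slot_exponent_le (phase_lt n j); have := beta_gt n; lia.
have := beta_gt n; lia.
Qed.

Lemma exponent_top n (j : int) : (j <= - (ramp n)%:Z) || ((4 * qq n)%:Z <= j <= (5 * qq n)%:Z)
  || ((8 * qq n)%:Z <= j) -> exponent n j = (beta n)%:Z.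
Proof.
move=> H; apply/le_anti; rewrite exponent_le/=.
rewrite /exponent /block_exponent; lia.
Qed.

Lemma exponent_slot n (j : int) : on n j -> (phase n j <= guard (typ n))%N ->
  (typ n)%:Z + 2 <= exponent n j.
Proof. by rewrite /exponent /block_exponent => -> pg; rewrite /slot_exponent; lia. Qed.

Lemma exponent_low n (j : int) : 0 <= j <= (4 * qq n)%:Z - (ramp n)%:Z ->
  exponent n j = - n%:Z.
Proof.
move=> H; rewrite /exponent /block_exponent ifF; last first.
  by apply/negbTE; rewrite /on; move: H; rewrite /ramp /beta; lia.
move: H; have := ramp_qq n; rewrite {2 3}/ramp; lia.
Qed.

(** At distance [ramp n] from the plateaus [block_exponent] is at most [- n], so the dip [- typ n]
    of the slot is not masked. *)
Lemma exponent_hit n (j : int) : on n j -> phase n j = hit (typ n) ->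
  (5 * qq n + ramp n)%:Z <= j <= (8 * qq n)%:Z - (ramp n)%:Z ->
  exponent n j <= - (typ n)%:Z.
Proof.
move=> oj pj H; have an := on_act oj; rewrite /exponent /block_exponent oj /slot_exponent pj.
move: H; have := ramp_qq n; rewrite /hit /period; rewrite /ramp; lia.
Qed.

Lemma phaseS n (j : int) : (4 * qq n)%:Z <= j ->
  phase n (j + 1) = (phase n j).+1 \/
  (phase n j).+1 = period (typ n) /\ phase n (j + 1) = 0%N.
Proof.
move=> H; rewrite /phase.
have -> : absz (j + 1 - (4 * qq n)%:Z)%R = (absz (j - (4 * qq n)%:Z)%R).+1 by lia.
set a := `|_|%N; set p := period _; have p0 : (0 < p)%N by exact: period_gt0.
rewrite -addn1 -modnDml addn1.
have := ltn_pmod a p0; rewrite leq_eqVlt => /orP[/eqP E|h].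
  by right; rewrite E modnn.
by left; rewrite modn_small.
Qed.

Lemma phaseD n (j : int) (t : nat) : (4 * qq n)%:Z <= j -> (t <= phase n j)%N ->
  phase n (j - t%:Z) = (phase n j - t)%N /\ (4 * qq n)%:Z <= j - t%:Z.
Proof.
move=> H tj; have tl : (t <= `|j - (4 * qq n)%:Z|)%N.
  by apply: leq_trans tj _; exact: leq_mod.
split; last by lia.
rewrite /phase.
have -> : absz (j - t%:Z - (4 * qq n)%:Z)%R = (absz (j - (4 * qq n)%:Z)%R - t)%N by lia.
move: tj; rewrite /phase; set a := `|_|%N; set p := period _ => ta.
have p0 : (0 < p)%N by exact: period_gt0.
rewrite {1}(divn_eq a p) -addnBA// modnMDl modn_small//.
by apply: leq_ltn_trans (leq_subr _ _) _; exact: ltn_pmod.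
Qed.

Lemma block_exponent_lip n (j : int) :
  `|block_exponent n (j + 1) - block_exponent n j| <= 1.
Proof. rewrite /block_exponent; lia. Qed.

Lemma slot_exponent_lip n (j : int) : on n j ->
  `|slot_exponent (typ n) (phase n (j + 1)) - slot_exponent (typ n) (phase n j)| <= 1.
Proof.
move=> oj; have oj4 : (4 * qq n)%:Z <= j by case/and3P: oj.
have [->|[E ->]] := phaseS oj4; first by rewrite /slot_exponent; lia.
by rewrite /slot_exponent; move: E; rewrite /period; lia.
Qed.

Lemma max_lip (a b a' b' : int) : `|a' - a| <= 1 -> `|b' - b| <= 1 ->
  `|Num.max a' b' - Num.max a b| <= 1.
Proof. lia. Qed.

Lemma block_exponent_edge n (j : int) : on n j != on n (j + 1) ->
  (beta n)%:Z - 1 <= block_exponent n j /\ (beta n)%:Z - 1 <= block_exponent n (j + 1).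
Proof.
move=> H; have {H} : (j = (4 * qq n)%:Z - 1) \/ (j = (8 * qq n)%:Z - 1).
  by move: H; rewrite /on; case: act => //=; lia.
by rewrite /block_exponent; lia.
Qed.

(** The slot term jumps only at the ends of [on n]; there [block_exponent] is within 1 of [beta n]
    and dominates it. *)
Lemma exponent_lip n (j : int) : `|exponent n (j + 1) - exponent n j| <= 1.
Proof.
have bl := block_exponent_lip n j; rewrite /exponent.
have [E|E] := eqVneq (on n j) (on n (j + 1)).
  rewrite -E; case: ifPn => [oj|_]; last first.
    by apply: max_lip => //; rewrite subrr.
  by apply: max_lip => //; apply: max_lip; rewrite ?subrr// slot_exponent_lip.
have [b0 b1] := block_exponent_edge E; have b := beta_gt n.
have S k : on n k -> slot_exponent (typ n) (phase n k) <= (beta n)%:Z - 1.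
  by move=> /on_act; have := slot_exponent_le (phase_lt n k); lia.
have M k : Num.max (if on n k then slot_exponent (typ n) (phase n k) else - n%:Z)
    (- n%:Z) <= (beta n)%:Z - 1.
  by have := S k; case: ifPn => [_ /(_ isT)|_ _]; lia.
rewrite (max_r (le_trans (M _) b1)) (max_r (le_trans (M _) b0)); exact: bl.
Qed.

Lemma exponent_edge n (j : int) : exponent n j < (beta n)%:Z - 1 ->
  [/\ j != (4 * qq n)%:Z - 1, j != (4 * qq n)%:Z, j != (8 * qq n)%:Z - 1 &
      j != (8 * qq n)%:Z].
Proof.
move=> h; have {h} : block_exponent n j < (beta n)%:Z - 1.
  by apply: le_lt_trans h; rewrite le_max lexx orbT.
by move=> h; split; apply/eqP => E; move: h; rewrite E /block_exponent; lia.
Qed.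

Lemma exponent_step n (j : int) :
  exponent n (j + 1) <= exponent n j + 1 /\ exponent n j <= exponent n (j + 1) + 1.
Proof. by have := exponent_lip n j; lia. Qed.

(** * The two systems of vectors and the operators *)

Section blocks.
Context {R : realType} (idx : nat -> int -> nat) (dec : nat -> nat * int).
Context (idxK : forall n j, dec (idx n j) = (n, j)).
Context (decK : forall i, idx (dec i).1 (dec i).2 = i).
Context (tgt : nat -> seq (R[i] * (nat * int))).
Context (tgt_lt : forall l p, p \in tgt l -> (p.2.1 < l)%N).
Context (tgt_le : forall l,
  \sum_(p <- tgt l) normc p.1 * (2 * 2 ^+ beta p.2.1) <= 2 ^+ l).

Definition weight n j : R := 2 ^ exponent n j.

Definition fv n j : l1 R := (weight n j)%:C%C *: ee (idx n j).

Definition switch (b : bool) (v : l1 R) : l1 R := (b%:R : R[i]) *: v.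

Definition zeta_of (g : nat -> int -> l1 R) l (s : int) : l1 R :=
  \sum_(p <- tgt l) p.1 *: g p.2.1 (p.2.2 + s).

Definition shift n j : int := (phase n j)%:Z - (hit (typ n))%:Z.

(* Course-of-values recursion: [gtab N] is correct on the blocks n < N only, and
   zeta_of (gtab n) (typ n) only looks at blocks < typ n < n. *)
Fixpoint gtab N : nat -> int -> l1 R :=
  if N is N'.+1 then fun n j =>
    if n == N' then
      fv n j - switch ((0 < n)%N && ((4 * qq n)%:Z <= j)) (fv n.-1 j)
      + switch (on n j) (zeta_of (gtab N') (typ n) (shift n j))
    else gtab N' n j
  else fun _ _ => 0.

Definition gv n j := gtab n.+1 n j.
Definition zeta := zeta_of gv.

(* The k-th iterate, k in Z, of the vector [fv n j], see [iter_orb]. *)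
Fixpoint orb (k : int) n j : l1 R :=
  if n is n'.+1 then
    gv n (j + k) + switch ((4 * qq n)%:Z <= j) (orb k n' j)
    - switch (on n j) (zeta (typ n) (shift n j + k))
  else gv 0 (j + k).

Lemma on0 j : on 0 j = false. Proof. by []. Qed.

Lemma switch0 v : switch false v = 0. Proof. exact: scale0r. Qed.
Lemma switch1 v : switch true v = v. Proof. exact: scale1r. Qed.

Lemma linear_switch (A : {linear l1 R -> l1 R}) b v :
  A (switch b v) = switch b (A v).
Proof. exact: linearZ. Qed.

Lemma nm_switch b v : nm (switch b v) <= nm v.
Proof. by case: b; rewrite ?switch1// switch0 nm0 nm_ge0. Qed.

Lemma weight_gt0 n j : 0 < weight n j.
Proof. by rewrite exprz_gt0. Qed.

Lemma normc_real (r : R) : 0 <= r -> normc (r%:C%C) = r.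
Proof. by move=> r0; rewrite /normc/= expr0n/= addr0 sqrtr_sqr ger0_norm. Qed.

Lemma nm_fv n j : nm (fv n j) = weight n j.
Proof. by rewrite nmZ nm_ee mulr1 normc_real// ltW// weight_gt0. Qed.

Lemma weight_le n j : weight n j <= 2 ^+ beta n.
Proof. by rewrite /weight exprnP ler_eXz2l ?ltr1n// exponent_le. Qed.

Lemma typ_lt n j : on n j -> (typ n < n)%N.
Proof. by move=> /on_act; lia. Qed.

Lemma gtabS N n j : gtab N.+1 n j =
  if n == N then
    fv n j - switch ((0 < n)%N && ((4 * qq n)%:Z <= j)) (fv n.-1 j)
    + switch (on n j) (zeta_of (gtab N) (typ n) (shift n j))
  else gtab N n j.
Proof. by []. Qed.

Lemma gtabE N n j : (n < N)%N -> gtab N n j = gv n j.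
Proof.
elim: N => // N IH; rewrite ltnS leq_eqVlt => /predU1P[->//|nN].
by rewrite gtabS ltn_eqF// IH.
Qed.

Lemma gv0 j : gv 0 j = fv 0 j.
Proof. by rewrite /gv/= on0 !switch0 subr0 addr0. Qed.

Lemma gvS n j : gv n.+1 j = fv n.+1 j - switch ((4 * qq n.+1)%:Z <= j) (fv n j)
  + switch (on n.+1 j) (zeta (typ n.+1) (shift n.+1 j)).
Proof.
rewrite {1}/gv gtabS eqxx; congr (_ + _).
have [oj|] := boolP (on n.+1 j); last by rewrite !switch0.
rewrite !switch1 /zeta /zeta_of; apply: eq_big_seq => p /tgt_lt pl.
by rewrite (gtabE _ (ltn_trans pl (typ_lt oj))).
Qed.

Lemma zeta_linear (A : {linear l1 R -> l1 R}) (k : int) l s :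
  (forall m j, (m < l)%N -> A (gv m j) = gv m (j + k)) ->
  A (zeta l s) = zeta l (s + k).
Proof.
move=> Ag; rewrite /zeta /zeta_of linear_sum; apply: eq_big_seq => p /tgt_lt pl.
by rewrite linearZ/= Ag// addrA.
Qed.

Lemma orb0 k j : orb k 0 j = fv 0 (j + k). Proof. exact: gv0. Qed.

Lemma orbS k n j : orb k n.+1 j =
  gv n.+1 (j + k) + switch ((4 * qq n.+1)%:Z <= j) (orb k n j)
  - switch (on n.+1 j) (zeta (typ n.+1) (shift n.+1 j + k)).
Proof. by []. Qed.

(** A pure translation plus two defects. The second one is zero when [on] agrees at both ends and
    [shift] advances by exactly [k]. *)
Lemma orb_decomp k n j : orb k n.+1 j = fv n.+1 (j + k)
  + (switch ((4 * qq n.+1)%:Z <= j) (orb k n j)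
     - switch ((4 * qq n.+1)%:Z <= j + k) (fv n (j + k)))
  + (switch (on n.+1 (j + k)) (zeta (typ n.+1) (shift n.+1 (j + k)))
     - switch (on n.+1 j) (zeta (typ n.+1) (shift n.+1 j + k))).
Proof.
rewrite orbS gvS; set f := fv _ _; set s := switch _ (fv _ _); set o := switch _ (orb _ _ _).
set z := switch _ _; set z' := switch _ _.
by rewrite (addrAC _ z o) -[LHS]addrA -(addrA f) (addrC (- s)).
Qed.

Lemma orb_fv n j : orb 0 n j = fv n j.
Proof.
by elim: n j => [|n IH] j; rewrite ?orb0 ?orb_decomp !addr0// IH !subrr !addr0.
Qed.

(** [orb] is [gvS] solved for [fv] after translating the [gv]. Strong induction, since [zeta]
    involves all blocks below [typ n.+1]. *)
Lemma linear_gv (A : {linear l1 R -> l1 R}) k :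
  (forall n j, A (fv n j) = orb k n j) -> forall n j, A (gv n j) = gv n (j + k).
Proof.
move=> Af n; elim/ltn_ind: n => -[|n] IH j; first by rewrite gv0 Af orb0 gv0.
rewrite [in LHS]gvS linearD linearB !(linear_switch A) !Af orbS.
have [on1|] := boolP (on n.+1 j); last by rewrite !switch0 subr0 addr0 addrK.
rewrite (zeta_linear (k := k)) => [|m i ml]; last first.
  by apply: IH; apply: ltn_trans ml (typ_lt on1).
by rewrite !switch1 (addrAC _ (- zeta _ _)) addrK subrK.
Qed.

Lemma linear_orb (A : {linear l1 R -> l1 R}) k :
  (forall n j, A (fv n j) = orb k n j) ->
  forall k' n j, A (orb k' n j) = orb (k' + k) n j.
Proof.
move=> Af k'; have Ag := linear_gv Af.
elim=> [|n IH] j; first by rewrite !orb0 -!gv0 Ag addrA.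
rewrite !orbS linearB linearD !(linear_switch A) IH Ag addrA.
by rewrite (zeta_linear (k := k)) ?addrA// => m i _; exact: Ag.
Qed.

Lemma iter_orb (A : {linear l1 R -> l1 R}) k :
  (forall n j, A (fv n j) = orb k n j) ->
  forall t n j, iter t A (fv n j) = orb (k *+ t) n j.
Proof.
move=> Af; elim=> [|t IH] n j; first by rewrite mulr0n orb_fv.
by rewrite iterS IH (linear_orb Af) mulrSr.
Qed.

(** At both ends all [on] up to block [n] are off and all erasing indicators are on, so the defects
    of [orb_decomp] cancel. *)
Lemma orb_beyond k n j : (8 * qq n)%:Z <= j -> (8 * qq n)%:Z <= j + k ->
  orb k n j = fv n (j + k).
Proof.
have onF m i : (8 * qq m)%:Z <= i -> on m i = false by rewrite /on; lia.
elim: n => [|n IH] h1 h2; first exact: orb0.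
have e : (8 * qq n.+1 = 2 * (4 * qq n.+1))%N by lia.
have e' : (4 * qq n.+1 = 8 * qq n)%N by rewrite qqS mulnA.
rewrite orb_decomp !onF// !switch0 subrr addr0.
have i1 : (4 * qq n.+1)%:Z <= j by lia.
have i2 : (4 * qq n.+1)%:Z <= j + k by lia.
by rewrite i1 i2 IH -?e'// subrr addr0.
Qed.

Lemma idx_inj n j m i : (idx n j == idx m i) = (n == m) && (j == i).
Proof.
apply/eqP/andP => [/(congr1 dec)|[/eqP-> /eqP->]//].
by rewrite !idxK => -[-> ->].
Qed.

Lemma fvE n j m i : fv n j (idx m i) =
  if (n == m) && (j == i) then (weight n j)%:C%C else 0.
Proof.
rewrite l1_coordZ eeE idx_inj eq_sym [i == j]eq_sym.
by case: ifP => _; rewrite ?mulr1 ?mulr0.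
Qed.

(** * Norm bounds for the vectors and their orbits *)

Lemma pow_beta n : 8 * 2 ^+ beta n <= 2 ^+ beta n.+1 :> R.
Proof.
rewrite betaS -addnA exprD mulrC ler_pM2l ?exprn_gt0// exprD.
have : 1 <= 2 ^+ (2 * n) :> R by rewrite exprn_ege1 ?ler1n.
have -> : 2 ^+ 3 = 8 :> R by ring.
lra.
Qed.

Lemma pow_typ n j : on n.+1 j -> 2 ^+ typ n.+1 <= 2 ^+ beta n :> R.
Proof.
by move=> oj; rewrite ler_weXn2l ?ler1n//; have := typ_lt oj; have := beta_gt n; lia.
Qed.

(** Joint induction: [zeta l] uses blocks below [l], and [gv n] uses a target of type below [n]. The
    factor 2 matches the one in [tgt_le]. *)
Lemma nm_gv_zeta n : (forall j, nm (gv n j) <= 2 * 2 ^+ beta n) /\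
  (forall l s, (l <= n)%N -> nm (zeta l s) <= 2 ^+ l).
Proof.
elim/ltn_ind: n => n IH.
have Z l s : (l <= n)%N -> nm (zeta l s) <= 2 ^+ l.
  move=> ln; apply: le_trans (tgt_le l); apply: le_trans (nm_sum _ _ _) _.
  rewrite [leRHS]big_seq [leLHS]big_seq; apply: ler_sum => p pt.
  rewrite nmZ ler_wpM2l ?normc_ge0//.
  by have [->] := IH p.2.1 (leq_trans (tgt_lt pt) ln).
split=> // j; case: n IH Z => [|n] IH Z.
  by rewrite gv0 nm_fv (le_trans (weight_le _ _))// ler_peMl ?ler1n// exprn_ge0.
rewrite gvS; have h8 := pow_beta n; have b0 : 0 < 2 ^+ beta n :> R by rewrite exprn_gt0.
have := nm_switch ((4 * qq n.+1)%:Z <= j) (fv n j).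
have z1 : nm (switch (on n.+1 j) (zeta (typ n.+1) (shift n.+1 j))) <= 2 ^+ beta n.
  have [oj|] := boolP (on n.+1 j); last by rewrite switch0 nm0 ltW.
  by rewrite switch1; apply: le_trans (pow_typ oj); apply: Z; exact/ltnW/typ_lt/oj.
rewrite nm_fv; have := weight_le n j; have := weight_le n.+1 j; rewrite -(nm_fv n.+1).
move=> w1 w0 s1; apply: le_trans (nmD _ _) _; have := nmB (fv n.+1 j)
  (switch ((4 * qq n.+1)%:Z <= j) (fv n j)); lra.
Qed.

Lemma nm_gv n j : nm (gv n j) <= 2 * 2 ^+ beta n.
Proof. by have [h _] := nm_gv_zeta n; exact: h. Qed.

Lemma nm_zeta l s : nm (zeta l s) <= 2 ^+ l.
Proof. by have [_ h] := nm_gv_zeta l; exact: h. Qed.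

Lemma nm_switch_zeta n j s :
  nm (switch (on n.+1 j) (zeta (typ n.+1) s)) <= 2 ^+ beta n.
Proof.
have [oj|] := boolP (on n.+1 j); last by rewrite switch0 nm0 exprn_ge0.
by rewrite switch1; apply: le_trans (pow_typ oj); exact: nm_zeta.
Qed.

(** Uniform in the time [k]: block [n.+1] contributes one [gv] and one target, and [pow_beta]
    absorbs the lower blocks. *)
Lemma nm_orb k n j : nm (orb k n j) <= 4 * 2 ^+ beta n.
Proof.
elim: n j => [|n IH] j.
  rewrite -[orb _ _ _]/(gv 0 (j + k)); apply: le_trans (nm_gv _ _) _.
  by rewrite ler_pM2r ?exprn_gt0// ler_nat.
rewrite orbS; have h8 := pow_beta n; have b0 : 0 < 2 ^+ beta n :> R by rewrite exprn_gt0.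
have := nm_switch ((4 * qq n.+1)%:Z <= j) (orb k n j).
have := nm_switch_zeta n j (shift n.+1 j + k).
have := nm_gv n.+1 (j + k); have := IH j => i1 i2 i3 i4.
apply: le_trans (nmB _ _) _; have := nmD (gv n.+1 (j + k))
  (switch ((4 * qq n.+1)%:Z <= j) (orb k n j)); lra.
Qed.

Lemma nm_orb_tail k n j :
  nm (switch ((4 * qq n.+1)%:Z <= j) (orb k n j)
      - switch ((4 * qq n.+1)%:Z <= j + k) (fv n (j + k))
      + (switch (on n.+1 (j + k)) (zeta (typ n.+1) (shift n.+1 (j + k)))
         - switch (on n.+1 j) (zeta (typ n.+1) (shift n.+1 j + k))))
  <= 8 * 2 ^+ beta n.
Proof.
have b0 : 0 < 2 ^+ beta n :> R by rewrite exprn_gt0.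
have := nm_switch ((4 * qq n.+1)%:Z <= j) (orb k n j).
have := nm_switch ((4 * qq n.+1)%:Z <= j + k) (fv n (j + k)).
have := nm_switch_zeta n j (shift n.+1 j + k).
have := nm_switch_zeta n (j + k) (shift n.+1 (j + k)).
have := nm_orb k n j; rewrite nm_fv; have := weight_le n (j + k) => i0 i1 i2 i3 i4 i5.
apply: le_trans (nmD _ _) _.
apply: le_trans (lerD (nmB _ _) (nmB _ _)) _; lra.
Qed.

Lemma orb_coord0 k n j : normc (orb k n.+1 j (idx 0 0)) <= 8 * 2 ^+ beta n.
Proof.
rewrite orb_decomp -addrA l1_coordD fvE add0r.
exact: le_trans (nm_coord _ _) (nm_orb_tail _ _ _).
Qed.

Lemma weight_lip n (j k : int) : (k == 1) || (k == - 1) ->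
  weight n (j + k) <= 2 * weight n j.
Proof.
move=> hk; rewrite /weight -{2}[2]expr1z -expfzDr// ler_eXz2l ?ltr1n//.
rewrite -lerBlDr; apply: le_trans (ler_norm _) _.
case/orP: hk => /eqP ->; first exact: exponent_lip.
by rewrite distrC -{1}(subrK 1 j) exponent_lip.
Qed.

(** A discrepancy arises only when the phase wraps around. One of the two positions then has phase
    0, in a guard, so the exponent at [j] is at least [typ n + 1] and pays for two targets. *)
Lemma nm_zeta_jump n (j k : int) : (k == 1) || (k == - 1) -> on n j -> on n (j + k) ->
  nm (zeta (typ n) (shift n (j + k)) - zeta (typ n) (shift n j + k)) <= weight n j.
Proof.
move=> hk oj ojk.
have j4 : (4 * qq n)%:Z <= j by case/and3P: oj.
have big : (typ n)%:Z + 1 <= exponent n j ->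
    nm (zeta (typ n) (shift n (j + k)) - zeta (typ n) (shift n j + k)) <= weight n j.
  move=> h; apply: (@le_trans _ _ (2 ^+ typ n + 2 ^+ typ n)).
    by apply: le_trans (nmB _ _) (lerD (nm_zeta _ _) (nm_zeta _ _)).
  apply: (@le_trans _ _ (2 ^ ((typ n)%:Z + 1))); last by rewrite ler_eXz2l ?ltr1n.
  by rewrite expfzDr// expr1z mulr_natr mulr2n.
have small : shift n (j + k) = shift n j + k ->
    nm (zeta (typ n) (shift n (j + k)) - zeta (typ n) (shift n j + k)) <= weight n j.
  by move=> ->; rewrite subrr nm0 ltW// weight_gt0.
case/orP: hk => /eqP hk; rewrite hk in ojk big small *.
  have [e|[e e0]] := phaseS j4; first by apply: small; rewrite /shift e; lia.
  apply: big; have := exponent_slot ojk; rewrite e0 leq0n => /(_ isT).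
  by have [] := exponent_step n j; lia.
have [p0|p0] := posnP (phase n j).
  by apply: big; have := exponent_slot oj; rewrite p0 leq0n => /(_ isT); lia.
have [e _] := phaseD j4 p0; apply: small; rewrite /shift e; lia.
Qed.

(** Within 1 of the top exponent [nm_orb] suffices. Elsewhere no indicator changes, the defect from
    the lower block cancels by [orb_beyond], and only a jump of [zeta] remains. *)
Lemma nm_orb_step n (j k : int) : (k == 1) || (k == - 1) ->
  nm (orb k n j) <= 8 * weight n j.
Proof.
move=> hk; have w0 := weight_gt0 n j; have wk := weight_lip n j hk.
case: n w0 wk => [|n] w0 wk; first by rewrite orb0 nm_fv; lra.
have [top|/exponent_edge[e1 e2 e3 e4]] := leP ((beta n.+1)%:Z - 1) (exponent n.+1 j).
  apply: le_trans (nm_orb _ _ _) _.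
  rewrite (_ : 8 = 4 * 2); last by ring.
  rewrite -mulrA ler_pM2l// /weight -{2}[2]expr1z -expfzDr// exprnP ler_eXz2l ?ltr1n//.
  by lia.
have eb : ((4 * qq n.+1)%:Z <= j + k) = ((4 * qq n.+1)%:Z <= j).
  by move: hk e1 e2 => /orP[]/eqP-> /eqP ? /eqP ?; lia.
have eon : on n.+1 (j + k) = on n.+1 j.
  rewrite /on eb; congr [&& _, _ & _].
  by move: hk e3 e4 => /orP[]/eqP-> /eqP ? /eqP ?; lia.
rewrite orb_decomp eb eon.
have -> : switch ((4 * qq n.+1)%:Z <= j) (orb k n j)
    - switch ((4 * qq n.+1)%:Z <= j) (fv n (j + k)) = 0.
  have [h|h] := boolP ((4 * qq n.+1)%:Z <= j); last by rewrite !switch0 subrr.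
  have e' : (8 * qq n = 4 * qq n.+1)%N by rewrite qqS mulnA.
  by rewrite orb_beyond ?e' ?eb// subrr.
rewrite addr0; apply: le_trans (nmD _ _) _; rewrite nm_fv.
apply: (@le_trans _ _ (2 * weight n.+1 j + weight n.+1 j)); last by lra.
apply: lerD => //; have [oj|_] := boolP (on n.+1 j); last first.
  by rewrite !switch0 subrr nm0 ltW.
by rewrite !switch1; apply: nm_zeta_jump; rewrite ?eon.
Qed.

Lemma block_operator (k : int) : (k == 1) || (k == - 1) ->
  exists A : {linear l1 R -> l1 R},
    (forall n j, A (fv n j) = orb k n j) /\ forall x, nm (A x) <= 8 * nm x.
Proof.
move=> hk.
have [|A [Aee A8]] := @operator_exists R
    (fun i => ((weight (dec i).1 (dec i).2)^-1)%:C%C *: orb k (dec i).1 (dec i).2) 8.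
  move=> i; have w0 := weight_gt0 (dec i).1 (dec i).2.
  have wi : 0 <= (weight (dec i).1 (dec i).2)^-1 by rewrite invr_ge0 ltW.
  by rewrite nmZ (normc_real wi) ler_pdivrMl// mulrC nm_orb_step.
exists A; split=> // n j; have w0 := weight_gt0 n j.
by rewrite linearZ/= Aee idxK/= scalerA -rmorphM/= divff ?gt_eqF// scale1r.
Qed.

Lemma ee_fv i : ee i = ((weight (dec i).1 (dec i).2)^-1)%:C%C *: fv (dec i).1 (dec i).2.
Proof.
have w0 := weight_gt0 (dec i).1 (dec i).2.
by rewrite /fv decK scalerA -rmorphM/= mulVf ?gt_eqF// scale1r.
Qed.

Lemma block_operatorK (A A' : {linear l1 R -> l1 R}) k :
  (forall n j, A (fv n j) = orb k n j) -> (forall x, nm (A x) <= 8 * nm x) ->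
  (forall n j, A' (fv n j) = orb (- k) n j) -> (forall x, nm (A' x) <= 8 * nm x) ->
  cancel A A'.
Proof.
move=> Af A8 A'f A'8 x.
apply: (@bounded_eq R (A' \o A) idfun (8 * 8) 1) => [y|y|i]/=.
- by apply: le_trans (A'8 _) _; rewrite -mulrA ler_pM2l.
- by rewrite mul1r.
- by rewrite ee_fv linearZ/= Af linearZ/= (linear_orb A'f) subrr orb_fv.
Qed.

(** * Density of the rational combinations of the vectors [gv] *)

Definition cplx (u : rat * rat) : R[i] := (ratr u.1 +i* ratr u.2)%C.

Definition comb (a : seq ((rat * rat) * (nat * int))) : l1 R :=
  \sum_(p <- a) cplx p.1 *: gv p.2.1 p.2.2.

Lemma normc_approx (z : R[i]) (e : R) : 0 < e -> exists u, normc (z - cplx u) <= e.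
Proof.
have real_approx (a d : R) : 0 < d -> exists q, `|a - ratr q| <= d.
  move=> d0; have /rat_in_itvoo[q] : a - d < a + d by lra.
  rewrite in_itv/= => /andP[q1 q2]; exists q; rewrite ler_norml; lra.
move=> e0; case: z => a b; have e20 : 0 < e / 2 by rewrite divr_gt0.
have [p pa] := real_approx a _ e20; have [q qb] := real_approx b _ e20.
exists (p, q); apply: le_trans (normc_le_ReIm _) _ => /=.
by rewrite [e]splitr lerD.
Qed.

Definition appr (y : l1 R) := forall r : R, 0 < r -> exists a, nm (y - comb a) <= r.

Lemma comb_cat a b : comb (a ++ b) = comb a + comb b.
Proof. exact: big_cat. Qed.

Lemma appr0 : appr 0.
Proof. by move=> r r0; exists [::]; rewrite /comb big_nil subrr nm0 ltW. Qed.

Lemma apprD y z : appr y -> appr z -> appr (y + z).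
Proof.
move=> ya za r r0; have r20 : 0 < r / 2 by rewrite divr_gt0.
have [a aP] := ya _ r20; have [b bP] := za _ r20; exists (a ++ b).
rewrite comb_cat opprD addrACA [r]splitr; apply: le_trans (nmD _ _) _.
exact: lerD aP bP.
Qed.

Lemma appr_sum (I : eqType) (s : seq I) (g : I -> l1 R) :
  (forall i, i \in s -> appr (g i)) -> appr (\sum_(i <- s) g i).
Proof.
elim: s => [|i s IH] H; first by rewrite big_nil; exact: appr0.
rewrite big_cons; apply: apprD; first by apply: H; rewrite mem_head.
by apply: IH => k ks; apply: H; rewrite inE ks orbT.
Qed.

Lemma appr_gv c n j : appr (c *: gv n j).
Proof.
move=> r r0; have n0 : 0 < nm (gv n j) + 1 by rewrite ltr_wpDl ?nm_ge0.
have [u uP] := normc_approx c (divr_gt0 r0 n0).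
exists [:: (u, (n, j))]; rewrite /comb big_seq1 -scalerBl nmZ.
have := ler_pM (normc_ge0 _) (nm_ge0 (gv n j)) uP (ler_wpDr ler01 (lexx (nm (gv n j)))).
by rewrite divfK// gt_eqF.
Qed.

Lemma appr_switch b v c : appr (c *: v) -> appr (c *: switch b v).
Proof.
by case: b => h; rewrite ?switch1// switch0 scaler0; exact: appr0.
Qed.

(** Solving [gvS] for [fv n.+1] leaves [gv n.+1], a lower [fv n] and a combination of [gv]. *)
Lemma appr_fv c n j : appr (c *: fv n j).
Proof.
elim: n c => [|n IH] c; first by rewrite -gv0; exact: appr_gv.
have -> : fv n.+1 j = gv n.+1 j + switch ((4 * qq n.+1)%:Z <= j) (fv n j)
    - switch (on n.+1 j) (zeta (typ n.+1) (shift n.+1 j)).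
  by rewrite gvS (addrAC _ (switch (on _ _) _)) subrK addrK.
rewrite scalerBr scalerDr -scaleNr; apply: apprD.
  by apply: apprD; [exact: appr_gv|apply: appr_switch; exact: IH].
apply: appr_switch; rewrite /zeta /zeta_of scaler_sumr; apply: appr_sum => p _.
by rewrite scalerA; exact: appr_gv.
Qed.

Lemma appr_all y : appr y.
Proof.
move=> r r0; have r20 : 0 < r / 2 by rewrite divr_gt0.
have [K KP] := trunc_conv y r20.
have [|a aP] := (_ : appr (trunc y K)) _ r20.
  by apply: appr_sum => i _; rewrite ee_fv scalerA; exact: appr_fv.
exists a; apply: le_trans (nm_triangle (trunc y K) _ _) _.
by rewrite [r]splitr lerD// KP.
Qed.

(** * Telescoping along the orbit of the vectors at position 0 *)

Lemma orb_at0 k n : orb k n 0 = gv n k.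
Proof.
case: n => [|n]; first by rewrite orb0 gv0 add0r.
have h : ((4 * qq n.+1)%:Z <= 0) = false by have := qq_gt0 n.+1; lia.
by rewrite orbS /on h andbF !switch0 subr0 addr0 add0r.
Qed.

(** From [4 * qq n.+1 = 8 * qq n] on, block [n] no longer displays its target, and [gv n.+1] erases
    the remaining [fv n t]. *)
Lemma sum_gv n (t : int) : (4 * qq n)%:Z <= t ->
  \sum_(k < n.+1) gv k t = fv n t + switch (on n t) (zeta (typ n) (shift n t)).
Proof.
elim: n => [|n IH] nt.
  by rewrite big_ord_recr big_ord0/= gv0 on0 switch0 add0r addr0.
have e := qqS n; have q0 := qq_gt0 n.
rewrite big_ord_recr IH/=; last by lia.
have -> : on n t = false by rewrite /on; lia.
by rewrite switch0 addr0 gvS nt switch1 addrA [fv n t + _]addrC subrK.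
Qed.

Lemma gv_before n (t : int) : t < (4 * qq n)%:Z -> gv n t = fv n t.
Proof.
case: n => [|n] h; first exact: gv0.
have h' : ((4 * qq n.+1)%:Z <= t) = false by lia.
by rewrite gvS /on h' andbF !switch0 subr0 addr0.
Qed.

Lemma weight_low n (t : int) : 0 <= t <= (4 * qq n)%:Z - (ramp n)%:Z ->
  weight n t = (2 ^+ n)^-1.
Proof. by move=> h; rewrite /weight exponent_low// exprnN. Qed.

Lemma sum_geometric n K : \sum_(n <= k < K) (2 ^+ k.+1)^-1 <= (2 ^+ n)^-1 :> R.
Proof.
have p k : 0 < (2 ^+ k)^-1 :> R by rewrite invr_gt0 exprn_gt0.
have pS k : (2 ^+ k.+1)^-1 = (2 ^+ k)^-1 / 2 :> R by rewrite exprS invfM mulrC.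
have [nK|Kn] := leqP n K; last by rewrite big_geq ?(ltW (p _))// ltnW.
have -> : \sum_(n <= k < K) (2 ^+ k.+1)^-1 = (2 ^+ n)^-1 - (2 ^+ K)^-1 :> R.
  rewrite -(subnKC nK); elim: (K - n)%N => [|d IH]; first by rewrite addn0 big_geq// subrr.
  rewrite addnS big_nat_recr ?leq_addr//= IH pS; lra.
by rewrite lerBlDr lerDl ltW.
Qed.

(** * The forward orbits *)

Section forward.
Context (A : {linear l1 R -> l1 R}).
Context (Af : forall n j, A (fv n j) = orb 1 n j).
Context (A8 : forall x, nm (A x) <= 8 * nm x).

Lemma iter_bounded t x : nm (iter t A x) <= 8 ^+ t * nm x.
Proof.
elim: t => [|t IH]; first by rewrite mul1r.
by rewrite iterS exprS -mulrA; apply: le_trans (A8 _) _; rewrite ler_pM2l.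
Qed.

Lemma iterB t x y : iter t A (x - y) = iter t A x - iter t A y.
Proof. by elim: t => // t IH; rewrite !iterS IH linearB. Qed.

Lemma iter_sum t (I : Type) (s : seq I) (g : I -> l1 R) :
  iter t A (\sum_(i <- s) g i) = \sum_(i <- s) iter t A (g i).
Proof. by elim: t => // t IH; rewrite iterS IH linear_sum. Qed.

Lemma fhc_vector : exists x0, conv (fun K => \sum_(k < K) fv k 0) x0.
Proof.
apply: (@sum_conv _ (fun k => fv k 0) 2) => K.
rewrite (eq_bigr (fun k : 'I_K => (2 ^+ k)^-1)); last first.
  move=> k _; rewrite nm_fv weight_low//.
  by have := ramp_qq k; have := qq_gt0 k; lia.
have -> : \sum_(k < K) (2 ^+ k)^-1 = 2 * \sum_(0 <= k < K) (2 ^+ k.+1)^-1 :> R.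
  rewrite big_mkord mulr_sumr; apply: eq_bigr => k _.
  by rewrite exprS invfM mulrA divff// mul1r.
by have := sum_geometric 0 K; rewrite expr0 invr1; lra.
Qed.

(** Two errors remain after telescoping: [fv n t], light at a hit, and the blocks above [n], which
    are still in their low range. *)
Lemma hit_close x0 n (t : nat) : conv (fun K => \sum_(k < K) fv k 0) x0 ->
  on n t -> phase n t = hit (typ n) ->
  (5 * qq n + ramp n <= t)%N -> (t + ramp n.+1 <= 8 * qq n)%N ->
  nm (iter t A x0 - zeta (typ n) 0) <= 2 * (2 ^+ typ n)^-1.
Proof.
move=> cx ont pt t1 t2; have tn := typ_lt ont.
have lip := conv_lipschitz (f := iter t A) (C := 8 ^+ t) _ cx.
apply: (@conv_ub _ _ _ _ _ n.+1 (lip _)) => [y z|K nK].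
  by rewrite -iterB; exact: iter_bounded.
rewrite /= iter_sum.
have -> : \sum_(k < K) iter t A (fv k 0) = \sum_(k < K) gv k t.
  by apply: eq_bigr => k _; rewrite (iter_orb Af) orb_at0 natz.
rewrite (sum_ord_split (fun k => gv k t%:Z) nK) sum_gv; last by lia.
rewrite ont switch1 /shift pt subrr addrAC addrK.
have wk k : (n < k)%N -> nm (gv k t) = (2 ^+ k)^-1.
  move=> nk; have r1 := ramp_qq k; have q1 := leq_qq nk; have q0 := qqS n.
  have h : (t + ramp k <= 4 * qq k)%N.
    move: nk; rewrite leq_eqVlt => /predU1P[<-|nk]; first by lia.
    by have := leq_qq nk; rewrite !qqS; lia.
  rewrite gv_before; last first.
    by have : (0 < ramp k)%N by []; lia.
  by rewrite nm_fv weight_low//; lia.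
apply: le_trans (nmD _ _) _; rewrite mulr_natl mulr2n; apply: lerD.
  rewrite nm_fv /weight [leRHS]exprnN ler_eXz2l ?ltr1n//.
  apply: exponent_hit => //; have r := rampS_qq n; have := qq_gt0 n.
  have : (ramp n <= ramp n.+1)%N by rewrite /ramp betaS; lia.
  lia.
apply: le_trans (nm_sum _ _ _) _.
apply: (@le_trans _ _ (2 ^+ n)^-1); last first.
  by rewrite lef_pV2 ?posrE ?exprn_gt0// ler_weXn2l ?ler1n// ltnW.
rewrite (eq_big_nat _ _ (F2 := fun k => (2 ^+ k)^-1)) => [|k /andP[nk _]]; last exact: wk.
case: K nK => // K nK; rewrite big_add1; exact: sum_geometric.
Qed.

(** * Frequency of the hits *)

Lemma typ_odd_part l m : typ (2 ^ l * m.*2.+1) = l.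
Proof.
rewrite /typ lognM ?expn_gt0// lognX -[logn 2 2]/1%N muln1.
by rewrite lognE/= dvdn2/= odd_double addn0.
Qed.

(** Takes the last block of type [l] that has ended by time [N]. *)
Lemma block_between l m0 N : (8 * qq (2 ^ l * m0.*2.+1) <= N)%N ->
  exists2 m, (m0 <= m)%N &
    (8 * qq (2 ^ l * m.*2.+1) <= N < 8 * qq (2 ^ l * m.+1.*2.+1))%N.
Proof.
move=> h0.
have bnd m : (8 * qq (2 ^ l * m.*2.+1) <= N)%N -> (m <= N)%N.
  apply: leq_trans; apply: (@leq_trans (qq m)).
    by rewrite /qq ltnW// (leq_trans (ltn_expl m (ltnSn 1)))// leq_pexp2l// leq_addr.
  rewrite (leq_trans (leq_qq (_ : m <= 2 ^ l * m.*2.+1)%N))//; last by rewrite leq_pmull.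
  by apply: (@leq_trans (1 * m.*2.+1)); [lia|rewrite leq_mul2r expn_gt0 orbT].
case: (ex_maxnP (ex_intro _ m0 h0) bnd) => m mN mmax.
exists m; first exact: mmax.
by rewrite mN ltnNge; apply/negP => /mmax; rewrite ltnn.
Qed.

Lemma hit_count (V : set nat) n N : act n -> (2 * period (typ n) <= qq n)%N ->
  (8 * qq n <= N)%N ->
  (forall t : nat, on n t -> phase n t = hit (typ n) ->
    (5 * qq n + ramp n <= t)%N -> (t + ramp n.+1 <= 8 * qq n)%N -> V t) ->
  (qq n %/ period (typ n) <= #|[set t : 'I_N.+1 | (t : nat) \in V]%SET|)%N.
Proof.
move=> an pq qN VP; set P := period (typ n) in pq *.
have P0 : (0 < P)%N by exact: period_gt0.
(* [k0] periods pass the plateau and its slope; [qq n %/ P] hits starting there still end before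
   [8 * qq n - ramp n.+1]. *)
set k0 := ((qq n + ramp n) %/ P).+1.
have k0P : (qq n + ramp n <= k0 * P <= qq n + ramp n + P)%N.
  by rewrite ltnW ?ltn_ceil//= mulSn addnC leq_add2r leq_trunc_div.
apply: (@count_ge V N _ (4 * qq n + hit (typ n) + k0 * P) P) => // k kK.
have kP : (k * P + P <= qq n)%N.
  by rewrite addnC -mulSn; apply: leq_trans (leq_trunc_div (qq n) P); rewrite leq_mul2r kK orbT.
have hP : (hit (typ n) < P)%N by rewrite /hit /P /period; lia.
have r1 := ramp_qq n; have r2 := rampS_qq n; have r0 : (0 < ramp n.+1)%N by [].
split; first by lia.
apply: VP; [|rewrite /phase -/P|lia|lia].
  by rewrite /on an/=; lia.
have -> : absz ((4 * qq n + hit (typ n) + k0 * P + k * P)%N%:Z - (4 * qq n)%:Z)%R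
  = (k0 * P + k * P + hit (typ n))%N by lia.
by rewrite -mulnDl modnMDl modn_small.
Qed.

Context (tgt_all : forall a l0, exists2 l, (l0 <= l)%N &
  tgt l = [seq (cplx p.1, p.2) | p <- a]).

Lemma forward_frequently_hypercyclic : @frequently_hypercyclic R (l1 R) A.
Proof.
have [x0 cx] := fhc_vector; exists x0 => U oU [z Uz].
have [r r0 rU] := nbhs_nm_ball oU Uz; have r20 : 0 < r / 2 by rewrite divr_gt0.
have [a aP] := appr_all z (divr_gt0 r20 (@ltr0n R 2)).
(* As [8 / r < 2 ^ l], the error of [hit_close] is below [r / 4], to be added to the [r / 4] of
   [comb a]. *)
have [l lb tl] := tgt_all a (Num.bound (8 / r)).
have zl : zeta l 0 = comb a.
  rewrite /zeta /zeta_of tl big_map; apply: eq_bigr => p _.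
  by rewrite addr0.
have l8 : 2 * (2 ^+ l)^-1 < r / 4.
  have := upper_nthrootP lb; rewrite ltr_pdivrMr// => h.
  have p0 : 0 < 2 ^+ l :> R by rewrite exprn_gt0.
  by rewrite ltr_pdivrMr//; lra.
(* Consecutive indices of type [l] differ by [2 ^ l.+1], so [c] is the ratio of their [qq]. *)
set P := period l; set c := (2 ^ (2 ^ l.+1))%N.
have P0 : (0 < P)%N by exact: period_gt0.
have c0 : (0 < c)%N by rewrite expn_gt0.
(* Makes block [n] active and ensures [2 * P <= qq n]. *)
set m0 := (2 * P + l.*2 + 3)%N.
(* From [N < 8 * c * qq n] and [qq n <= 2 * (qq n %/ P) * P]. *)
apply/lower_density_gt0P; exists (16 * P * c)%:R^-1.
  by rewrite invr_gt0 ltr0n !muln_gt0 P0 c0.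
exists (8 * qq (2 ^ l * m0.*2.+1))%N => N /block_between[m m0m /andP[]].
set n := (2 ^ l * m.*2.+1)%N => qN.
have mn : (m <= n)%N.
  by apply: (@leq_trans (1 * m.*2.+1)); [lia|rewrite leq_mul2r expn_gt0 orbT].
have tn : typ n = l by exact: typ_odd_part.
have -> : (2 ^ l * m.+1.*2.+1 = n + 2 ^ l.+1)%N.
  by rewrite /n expnS; lia.
have -> : qq (n + 2 ^ l.+1) = (c * qq n)%N by rewrite /qq -expnD; congr (2 ^ _)%N; lia.
move=> Nq.
have nq : (n <= qq n)%N.
  by rewrite /qq ltnW// (leq_trans (ltn_expl n (ltnSn 1)))// leq_pexp2l// leq_addr.
have an : act n by rewrite /act tn; lia.
have pq : (2 * P <= qq n)%N by lia.
have h : (qq n %/ P <= #|[set t : 'I_N.+1 | (t : nat) \in return_set A x0 U]%SET|)%N.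
  rewrite /P -tn; apply: hit_count => //; first by rewrite tn.
  move=> t ont pt t1 t2; apply: rU.
  apply: le_lt_trans (nm_triangle (zeta (typ n) 0) _ _) _.
  have := hit_close cx ont pt t1 t2; rewrite tn zl -(nmC z) => h.
  by have := r0; lra.
have qD : (qq n <= 2 * (qq n %/ P) * P)%N.
  have := divn_eq (qq n) P; have := ltn_pmod (qq n) P0.
  have : (2 <= qq n %/ P)%N by rewrite leq_divRL.
  set D := (_ %/ _)%N => D2; set M := (_ %% _)%N => MP E.
  have : (2 * P <= D * P)%N by rewrite leq_mul2r D2 orbT.
  by rewrite -mulnA; lia.
rewrite ler_pdivrMl ?ltr0n ?muln_gt0 ?P0 ?c0//.
rewrite -natrM ler_nat; apply: (@leq_trans (16 * P * c * (qq n %/ P))).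
  apply: leq_trans Nq _.
  rewrite (_ : 16 * P * c * _ = 8 * (c * (2 * (qq n %/ P) * P)))%N; last by ring.
  by rewrite !leq_mul2l qD !orbT.
by rewrite leq_mul2l h orbT.
Qed.

End forward.

Lemma guardE m : guard m = (2 ^ m * (8 * qq m))%N.
Proof. by rewrite /guard /qq -[8%N]/(2 ^ 3)%N -!expnD; congr (2 ^ _)%N; lia. Qed.

Lemma leq_guard m n : (m <= n)%N -> (guard m <= guard n)%N.
Proof. by move=> mn; rewrite leq_pexp2l//; lia. Qed.

(** * Tracking a block along backward orbits *)

Section tracking.
Context (m t : nat) (t_ge : (2 * (8 * qq m) <= t)%N) (t_le : (t <= guard m)%N).

Definition tracked i := ((dec i).1 == m) && ((dec i).2 < (8 * qq m)%:Z).
Definition track i := idx m ((dec i).2 - t%:Z).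
(* [track i] is the place to which T^(-t) moves the i-th basis vector.  A vector
   that vanishes at these places does not interfere with the tracked mass. *)
Definition vanish (v : l1 R) := forall i, tracked i -> v (track i) = 0.

Lemma vanishD u v : vanish u -> vanish v -> vanish (u + v).
Proof. by move=> u0 v0 i ti; rewrite l1_coordD u0// v0// addr0. Qed.

Lemma vanishN v : vanish v -> vanish (- v).
Proof. by move=> v0 i ti; rewrite l1_coordN v0// oppr0. Qed.

Lemma vanishB u v : vanish u -> vanish v -> vanish (u - v).
Proof. by move=> u0 v0; apply: vanishD => //; exact: vanishN. Qed.

Lemma vanishZ c v : vanish v -> vanish (c *: v).
Proof. by move=> v0 i ti; rewrite l1_coordZ v0// mulr0. Qed.

Lemma vanish_sum (I : eqType) (s : seq I) (g : I -> l1 R) :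
  (forall i, i \in s -> vanish (g i)) -> vanish (\sum_(i <- s) g i).
Proof.
move=> H i ti; rewrite l1_coord_sum big_seq big1// => k ks.
exact: H ks _ ti.
Qed.

Lemma vanish0 : vanish 0. Proof. by move=> i _; rewrite l1_coord0. Qed.

Lemma vanish_switch (b : bool) v : (b -> vanish v) -> vanish (switch b v).
Proof. by case: b => h; rewrite ?switch1 ?switch0; [exact: h|exact: vanish0]. Qed.

Lemma vanish_fv n (j : int) : (n != m) || ((8 * qq m)%:Z - t%:Z <= j) -> vanish (fv n j).
Proof.
move=> h i /andP[_ ti]; rewrite fvE; case: ifP => // /andP[/eqP nm' /eqP jE].
by move: h; rewrite nm' eqxx/= jE; lia.
Qed.

Lemma vanish_zeta l s : (l <= m)%N -> (forall n j, (n < l)%N -> vanish (gv n j)) ->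
  vanish (zeta l s).
Proof.
move=> lm H; apply: vanish_sum => p pt; apply: vanishZ; apply: H.
exact: tgt_lt.
Qed.

Lemma vanish_gv n j : (n < m)%N -> vanish (gv n j).
Proof.
elim/ltn_ind: n j => -[|n] IH j nm'.
  by rewrite gv0; apply: vanish_fv; rewrite ltn_eqF.
rewrite gvS; apply: vanishD; [apply: vanishB|].
- by apply: vanish_fv; rewrite ltn_eqF.
- by apply: vanish_switch => _; apply: vanish_fv; rewrite ltn_eqF// ltnW.
- apply: vanish_switch => oj; have tn := typ_lt oj.
  apply: vanish_zeta => [|k i kn]; first by rewrite ltnW// (ltn_trans tn).
  by apply: IH; [exact: ltn_trans tn|exact: ltn_trans (ltn_trans kn tn) nm'].
Qed.

Lemma vanish_zeta_le l s : (l <= m)%N -> vanish (zeta l s).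
Proof. by move=> lm; apply: vanish_zeta => // n j nl; apply/vanish_gv/(leq_trans nl). Qed.

Lemma vanish_orb_lt k n j : (n < m)%N -> vanish (orb k n j).
Proof.
elim: n j => [|n IH] j nm'; first by rewrite orb0 -gv0; exact: vanish_gv.
rewrite orbS; apply: vanishB; [apply: vanishD|].
- exact: vanish_gv.
- by apply: vanish_switch => _; apply: IH; exact: ltnW.
- by apply: vanish_switch => oj; apply: vanish_zeta_le; rewrite ltnW// (ltn_trans (typ_lt oj)).
Qed.

(** The defects of [orb_decomp] involve lower blocks and targets of type below [m], none of which
    reaches block [m]. *)
Lemma vanish_orb_eq j : vanish (orb (- t%:Z) m j - fv m (j - t%:Z)).
Proof.
have : forall n, n = m -> vanish (orb (- t%:Z) n j - fv n (j - t%:Z)); last exact.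
case=> [|n] nm'; first by rewrite orb0 subrr; exact: vanish0.
rewrite orb_decomp -[fv _ _ + _ + _]addrA [fv _ _ + _]addrC addrK; apply: vanishD; apply: vanishB;
  apply: vanish_switch => h.
- by apply: vanish_orb_lt; rewrite -nm'.
- by apply: vanish_fv; rewrite -nm' ltn_eqF.
- by apply: vanish_zeta_le; rewrite -nm' ltnW// (typ_lt h).
- by apply: vanish_zeta_le; rewrite -nm' ltnW// (typ_lt h).
Qed.

(** A target of type at most [m] does not interfere. An active block of larger type is long,
    [t <= guard m <= guard (typ n) <= qq n], whence the second alternative. *)
Lemma vanish_orb_beyond n j : (m <= n)%N -> (8 * qq n)%:Z <= j ->
  vanish (orb (- t%:Z) n j) \/ (t <= qq n)%N.
Proof.
elim: n => [|n IH] mn nj.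
  have m0 : m = 0%N by case: m mn.
  left; rewrite orb0; apply: vanish_fv; rewrite m0; lia.
move: mn; rewrite leq_eqVlt => /predU1P[mE|mn].
  left; rewrite -mE -(subrK (fv m (j - t%:Z)) (orb _ _ _)).
  apply: vanishD; first exact: vanish_orb_eq.
  by apply: vanish_fv; rewrite mE; lia.
have e := qqS n; have nj' : (8 * qq n)%:Z <= j by lia.
have [o|tq] := IH mn nj'; last by right; lia.
have fvn : (4 * qq n.+1)%:Z <= j - t%:Z -> vanish (fv n (j - t%:Z)).
  move=> h; have [nE|nm'] := eqVneq n m; apply: vanish_fv; last by rewrite nm'.
  by rewrite nE in e h *; lia.
have [tm|mt] := leqP (typ n.+1) m; last first.
  have [an|nan] := boolP (act n.+1).
    by right; rewrite (leq_trans t_le)// (leq_trans _ (act_guard an))// leq_guard// ltnW.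
  left; rewrite orb_decomp /on (negbTE nan) !switch0 subrr addr0.
  apply: vanishD; first by apply: vanish_fv; rewrite gtn_eqF.
  by apply: vanishB; apply: vanish_switch.
left; rewrite orb_decomp; apply: vanishD; [apply: vanishD|].
- by apply: vanish_fv; rewrite gtn_eqF.
- by apply: vanishB; apply: vanish_switch.
- by apply: vanishB; apply: vanish_switch => _; exact: vanish_zeta_le.
Qed.

Context (M : nat).

Definition phi (v : l1 R) := \sum_(i < M | tracked i) normc (v (track i)).

Lemma track_inj i k : tracked i -> tracked k -> track i = track k -> i = k.
Proof.
move=> /andP[/eqP i1 _] /andP[/eqP k1 _] /(congr1 dec); rewrite !idxK => -[/addIr e].
by rewrite -(decK i) -(decK k) i1 k1 e.
Qed.

Lemma phi_vanish v : vanish v -> phi v = 0.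
Proof. by move=> v0; rewrite /phi big1// => i ti; rewrite v0// normc0. Qed.

(** [track] is injective on tracked indices, so no coordinate is counted twice. *)
Lemma phi_nm v : phi v <= nm v.
Proof.
pose N := (\max_(i < M) (track i).+1)%N.
apply: le_trans (nm_partial v N); rewrite big_mkord.
have tN (i : 'I_M) : (track i < N)%N by exact: (leq_bigmax i).
pose g (i : 'I_M) : 'I_N := Ordinal (tN i).
rewrite /phi (eq_bigr (fun i => normc (v (g i))))//.
rewrite -(big_imset (fun k : 'I_N => normc (v k)) (h := g) (A := [pred i : 'I_M | tracked i]))/=.
  rewrite [leRHS](bigID (mem (g @: [pred i : 'I_M | tracked i])))/= lerDl.
  by apply: sumr_ge0 => i _; exact: normc_ge0.
move=> i k; rewrite !inE => ti tk /(congr1 (@nat_of_ord _))/= /track_inj-/(_ ti tk).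
exact: val_inj.
Qed.

Lemma phiD u v : phi (u + v) <= phi u + phi v.
Proof.
by rewrite /phi -big_split; apply: ler_sum => i _; rewrite l1_coordD; exact: le_normcD.
Qed.

Lemma phiZ c v : phi (c *: v) = normc c * phi v.
Proof. by rewrite /phi mulr_sumr; apply: eq_bigr => i _; rewrite l1_coordZ normcM. Qed.

(* Interference needs a reset of s in block n or n - 1 at a position in
   (j - t, j]; then j lies in a guard, whose weight absorbs it. *)
Lemma phi_orb_gt n j : (m < n)%N -> phi (orb (- t%:Z) n j) <= weight n j.
Proof.
case: n => // n mn; have w0 := weight_gt0 n.+1 j.
have q0 := qq_gt0 n.+1; have e := qqS n.
have fv0 : vanish (fv n.+1 (j - t%:Z)) by apply: vanish_fv; rewrite gtn_eqF.
have [jq|qj] := ltP j (4 * qq n.+1)%:Z.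
  rewrite orb_decomp /on (_ : ((4 * qq n.+1)%:Z <= j) = false); last by lia.
  rewrite (_ : ((4 * qq n.+1)%:Z <= j - t%:Z) = false); last by lia.
  by rewrite !andbF !switch0 subrr !addr0 phi_vanish// ltW.
rewrite orb_decomp -addrA; apply: le_trans (phiD _ _) _; rewrite phi_vanish// add0r.
have [top|] := boolP ((j <= (5 * qq n.+1)%:Z) || ((8 * qq n.+1)%:Z <= j)).
  have -> : weight n.+1 j = 2 ^+ beta n.+1.
    by rewrite /weight exponent_top// qj; case/orP: top => ->; rewrite ?orbT.
  apply: le_trans (pow_beta n).
  by apply: le_trans (phi_nm _) _; exact: nm_orb_tail.
rewrite negb_or -!ltNge => /andP[j5 j8].
have v2 : vanish (switch ((4 * qq n.+1)%:Z <= j) (orb (- t%:Z) n j)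
    - switch ((4 * qq n.+1)%:Z <= j - t%:Z) (fv n (j - t%:Z))).
  have [h|h] := leP (4 * qq n.+1)%:Z (j - t%:Z).
    by rewrite qj !switch1 orb_beyond ?subrr; [exact: vanish0|lia|lia].
  rewrite qj switch1 switch0 subr0.
  have nj : (8 * qq n)%:Z <= j by lia.
  (* The alternative [t <= qq n] is excluded: [j > 5 * qq n.+1] and [j - t < 4 * qq n.+1] force
     [t > qq n.+1]. *)
  by have [//|] := vanish_orb_beyond mn nj; lia.
apply: le_trans (phiD _ _) _; rewrite phi_vanish// add0r.
have [an|nan] := boolP (act n.+1); last first.
  by rewrite /on (negbTE nan) !switch0 subrr phi_vanish ?ltW//; exact: vanish0.
have [tm|mt] := leqP (typ n.+1) m.
  rewrite phi_vanish ?ltW//.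
  by apply: vanishB; apply: vanish_switch => _; exact: vanish_zeta_le.
have tg : (t <= guard (typ n.+1))%N by rewrite (leq_trans t_le)// leq_guard// ltnW.
have gq := act_guard an.
have oj : on n.+1 j by rewrite /on an qj j8.
have ojt : on n.+1 (j - t%:Z) by rewrite /on an/=; lia.
rewrite oj ojt !switch1.
have [tp|pt] := leqP t (phase n.+1 j).
  have [pE _] := phaseD qj tp.
  rewrite (_ : shift n.+1 (j - t%:Z) = shift n.+1 j - t%:Z); last by rewrite /shift pE; lia.
  by rewrite subrr phi_vanish ?ltW//; exact: vanish0.
apply: le_trans (phi_nm _) _.
apply: (@le_trans _ _ (2 ^+ typ n.+1 + 2 ^+ typ n.+1)).
  by apply: le_trans (nmB _ _) (lerD (nm_zeta _ _) (nm_zeta _ _)).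
apply: (@le_trans _ _ (2 ^ ((typ n.+1)%:Z + 1))).
  by rewrite expfzDr// expr1z mulr_natr mulr2n.
rewrite ler_eXz2l ?ltr1n//.
by have := exponent_slot oj (ltnW (leq_trans pt tg)); lia.
Qed.

Lemma phi_orb n j : ~~ ((n == m) && (j < (8 * qq m)%:Z)) ->
  phi (orb (- t%:Z) n j) <= weight n j.
Proof.
move=> h; have w0 := weight_gt0 n j.
have [nm'|mn|nE] := ltngtP n m; last rewrite nE eqxx/= -leNgt in h *.
- by rewrite phi_vanish ?ltW//; exact: vanish_orb_lt.
- exact: phi_orb_gt.
- rewrite phi_vanish; first by rewrite -nE ltW.
  rewrite -(subrK (fv m (j - t%:Z)) (orb _ _ _)).
  apply: vanishD; first exact: vanish_orb_eq.
  by apply: vanish_fv; rewrite eqxx/=; lia.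
Qed.

(** On tracked indices the iterate is diagonal. As [t] is at least [2 * (8 * qq m)], positions land
    below [- ramp m], where the weight is maximal. *)
Lemma orb_track i k : tracked i -> tracked k ->
  orb (- t%:Z) (dec i).1 (dec i).2 (track k) =
  if k == i then (2 ^+ beta m)%:C%C else 0.
Proof.
move=> ti tk; have /andP[/eqP im i2] := ti; rewrite im.
have := vanish_orb_eq (dec i).2 tk; rewrite l1_coordB => /eqP; rewrite subr_eq0 => /eqP->.
rewrite fvE eqxx/= /track; have -> : ((dec i).2 - t%:Z == (dec k).2 - t%:Z) = (k == i).
  apply/eqP/eqP => [/addIr e|->//]; have /andP[/eqP km _] := tk.
  by rewrite -(decK i) -(decK k) im km e.
case: eqP => // _; congr ((_)%:C%C); rewrite /weight exponent_top//.
by have := ramp_qq m; lia.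
Qed.

End tracking.

(** [x i / weight] is the coefficient of [x] along [fv]; this is the tracked mass measured in that
    system. *)
Definition block_mass m K (x : l1 R) :=
  \sum_(i < K | tracked m i) normc (x i) / weight (dec i).1 (dec i).2.

(** * The backward orbits *)

Section backward.
Context (S : {linear l1 R -> l1 R}).
Context (Sf : forall n j, S (fv n j) = orb (- 1) n j).
Context (S8 : forall x, nm (S x) <= 8 * nm x).

Lemma iter_trunc t x K :
  iter t S (trunc x K) = \sum_(i < K) x i *: iter t S (ee i).
Proof.
rewrite /trunc (iter_sum S); apply: eq_bigr => i _.
by elim: t => // t IH; rewrite !iterS IH linearZ.
Qed.

Lemma iter_ee t i : iter t S (ee i) =
  ((weight (dec i).1 (dec i).2)^-1)%:C%C *: orb (- t%:Z) (dec i).1 (dec i).2.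
Proof.
rewrite {1}ee_fv -[in RHS](_ : - 1 *+ t = - t%:Z); last by rewrite mulNrn natz.
rewrite -(iter_orb Sf); elim: t => // t IH.
by rewrite !iterS IH linearZ.
Qed.

(** [orb_track] gives the diagonal part; by [phi_orb] each untracked [ee i] interferes by at most 1
    in total, which costs at most [nm x]. *)
Lemma tracked_mass_trunc m t K x : (2 * (8 * qq m) <= t)%N -> (t <= guard m)%N ->
  2 ^+ beta m * block_mass m K x <= nm (iter t S (trunc x K)) + nm x.
Proof.
move=> t1 t2; set y := iter t S _.
have winv i : 0 <= (weight (dec i).1 (dec i).2)^-1 :> R.
  by rewrite invr_ge0 ltW// weight_gt0.
have yE (k : 'I_K) : tracked m k -> y (track m t k) =
    x k * (2 ^+ beta m / weight (dec k).1 (dec k).2)%:C%C +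
    \sum_(i < K | ~~ tracked m i) x i * (iter t S (ee i)) (track m t k).
  move=> tk; rewrite /y iter_trunc l1_coord_sum.
  rewrite (eq_bigr (fun i : 'I_K => x i * iter t S (ee i) (track m t k))); last first.
    by move=> i _; rewrite l1_coordZ.
  rewrite (bigID (fun i : 'I_K => tracked m i)) (bigD1 k)//.
  congr (_ + _); rewrite big1 ?addr0 => [|i /andP[ti /eqP ik]].
    rewrite iter_ee l1_coordZ (orb_track t1) ?eqxx//.
    by rewrite [LHS]addr0; congr (_ * _); rewrite [RHS]rmorphM mulrC.
  rewrite iter_ee l1_coordZ (orb_track t1) //.
  by case: eqP => [/val_inj ki|_]; [case: ik|rewrite !mulr0].
have phi1 (i : 'I_K) : ~~ tracked m i -> phi m t K (iter t S (ee i)) <= 1.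
  move=> ti; rewrite iter_ee phiZ normc_real// ler_pdivrMl ?weight_gt0// mulr1.
  exact: phi_orb.
have kb (k : 'I_K) : tracked m k ->
    2 ^+ beta m * (normc (x k) / weight (dec k).1 (dec k).2) <=
    normc (y (track m t k)) +
    \sum_(i < K | ~~ tracked m i) normc (x i) * normc (iter t S (ee i) (track m t k)).
  move=> tk; rewrite mulrCA -[X in normc (x k) * X]normc_real; last first.
    by rewrite mulr_ge0// exprn_ge0.
  rewrite -normcM -[X in normc X](addrK (\sum_(i < K | ~~ tracked m i)
    x i * (iter t S (ee i)) (track m t k))) -yE//.
  apply: le_trans (le_normcD _ _) _; rewrite lerD2l normcN.
  elim/big_rec2 : _ => [|i c z _ zc]; first by rewrite normc0.
  by apply: le_trans (le_normcD _ _) _; rewrite normcM lerD2l.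
rewrite /block_mass mulr_sumr; apply: le_trans (ler_sum _ kb) _.
rewrite big_split/= lerD//; first exact: phi_nm.
(* Summing over the tracked places first makes [phi] of each untracked image appear. *)
rewrite exchange_big/=.
apply: (@le_trans _ _ (\sum_(i < K | ~~ tracked m i) normc (x i))).
  apply: ler_sum => i ti; rewrite -mulr_sumr -[leRHS]mulr1 ler_wpM2l ?normc_ge0//.
  exact: phi1.
apply: le_trans (nm_partial x K); rewrite big_mkord [leLHS]big_mkcond/=.
by apply: ler_sum => i _; case: ifP => // _; exact: normc_ge0.
Qed.

Lemma block_mass_homo m x K K' : (K <= K')%N -> block_mass m K x <= block_mass m K' x.
Proof.
move=> KK'; rewrite /block_mass [leLHS]big_mkcond [leRHS]big_mkcond/=.
pose g i : R := if tracked m i then normc (x i) / weight (dec i).1 (dec i).2 else 0.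
rewrite -[leLHS]/(\sum_(i < K) g i) -[leRHS]/(\sum_(i < K') g i).
rewrite (sum_ord_split g KK') lerDl.
apply: sumr_ge0 => i _; rewrite /g; case: ifP => // _.
by rewrite divr_ge0 ?normc_ge0// ltW// weight_gt0.
Qed.

Lemma iter_conv t x : conv (fun K => iter t S (trunc x K)) (iter t S x).
Proof.
apply: (conv_lipschitz (f := iter t S) (C := 8 ^+ t) _ (trunc_conv x)) => y z.
by rewrite -iterB; exact: (iter_bounded S8).
Qed.

Lemma tracked_mass m t K x : (2 * (8 * qq m) <= t)%N -> (t <= guard m)%N ->
  2 ^+ beta m * block_mass m K x <= nm (iter t S x) + nm x.
Proof.
move=> t1 t2; apply/ler_addgt0Pr => e e0.
have [K0 K0P] := iter_conv t x e0; pose K' := maxn K0 K.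
apply: (@le_trans _ _ (2 ^+ beta m * block_mass m K' x)).
  by rewrite ler_pM2l ?exprn_gt0// block_mass_homo// leq_maxr.
apply: le_trans (tracked_mass_trunc _ _ t1 t2) _.
rewrite addrAC lerD2r -lerBlDl.
have := nmD (iter t S x) (iter t S (trunc x K') - iter t S x).
rewrite addrC subrK nmC; have := K0P K' (leq_maxl _ _); lra.
Qed.

(** By [tracked_mass], all visits up to time [guard m] occur before [2 * (8 * qq m)], a proportion
    below [2 / 2 ^ m], and [m] can be taken with [2 / 2 ^ m < e]. *)
Lemma unbounded_mass_not_frequent x :
  (forall m0, exists2 m, (m0 <= m)%N &
     exists K, 1 + nm x <= 2 ^+ beta m * block_mass m K x) ->
  ~ (0 < lower_density R (return_set S x (nm_ball 0%R 1%R)))%E.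
Proof.
move=> Hm /lower_density_gt0P[e e0 [N0 N0P]].
have [m mb [K mK]] := Hm (N0 + Num.bound (2 / e))%N.
have N0g : (N0 <= guard m)%N.
  apply: (@leq_trans m); first by apply: leq_trans mb; exact: leq_addr.
  by rewrite /guard ltnW// (leq_trans (ltn_expl m (ltnSn 1)))// leq_pexp2l//; lia.
have := N0P _ N0g; apply/negP; rewrite -ltNge.
have c : (#|[set n : 'I_(guard m).+1 |
    (n : nat) \in return_set S x (nm_ball 0%R 1%R)]%SET| <= 2 * (8 * qq m))%N.
  apply: count_le => t tg; rewrite /return_set /nm_ball/= subr0 => h.
  rewrite ltnNge; apply/negP => tq.
  by have := tracked_mass K x tq tg; lra.
apply: (@le_lt_trans _ _ (2 * (8 * qq m))%:R); first by rewrite ler_nat.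
have := upper_nthrootP (leq_trans (leq_addl N0 _) mb); rewrite ltr_pdivrMr// => h.
apply: (@lt_trans _ _ (e * (guard m)%:R)); last by rewrite ltr_pM2l// ltr_nat.
rewrite guardE 2![in ltRHS]natrM natrM natrX [ltRHS]mulrA -(natrM _ 8) ltr_pM2r; last first.
  by rewrite ltr0n muln_gt0 qq_gt0.
by rewrite mulrC.
Qed.

(** For [n.+1] only [beta n] enters, since the leading term of [orb_decomp] misses the coordinate
    (0, 0). This gain yields the decay in [coef_bound_beta]. *)
Definition coef_bound n : R := if n is n'.+1 then 8 * 2 ^+ beta n' else 4 * 2 ^+ beta 0.

Lemma coef_bound_ge0 n : 0 <= coef_bound n.
Proof. by case: n => [|n]; rewrite mulr_ge0// exprn_ge0. Qed.

Lemma orb_coef k n j : normc (orb k n j (idx 0 0)) <= coef_bound n.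
Proof.
case: n => [|n]; last exact: orb_coord0.
exact: le_trans (nm_coord _ _) (nm_orb _ _ _).
Qed.

Lemma coef_bound_beta n : coef_bound n / 2 ^+ beta n <= 4 * (2 ^+ n)^-1.
Proof.
rewrite ler_pdivrMr ?exprn_gt0// mulrAC ler_pdivlMr ?exprn_gt0//.
case: n => [|n]; first by rewrite mulr1.
rewrite /coef_bound betaS -addnA exprD -mulrA [leRHS]mulrCA [leLHS]mulrCA.
rewrite ler_pM2l ?exprn_gt0// exprD mulnC exprM exprS.
have : 1 <= 2 ^+ n :> R by rewrite exprn_ege1 ?ler1n.
have -> : 2 ^+ 3 = 8 :> R by ring.
set p := 2 ^+ n; rewrite expr2; nra.
Qed.

(** Tracked indices are controlled by the hypothesis; at positions from [8 * qq n] on, the weight is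
    [2 ^+ beta n]. *)
Lemma block_weight_sum n K (x : l1 R) : (forall K, 2 ^+ beta n * block_mass n K x < 1 + nm x) ->
  \sum_(i < K | (dec i).1 == n) normc (x i) / weight (dec i).1 (dec i).2 <=
  (1 + 2 * nm x) / 2 ^+ beta n.
Proof.
move=> small; have b0 : 0 < 2 ^+ beta n :> R by rewrite exprn_gt0.
rewrite (bigID (fun i : 'I_K => tracked n i))/=.
have -> : (1 + 2 * nm x) / 2 ^+ beta n =
    (1 + nm x) / 2 ^+ beta n + nm x / 2 ^+ beta n by rewrite -mulrDl; congr (_ / _); ring.
apply: lerD.
  rewrite ler_pdivlMr// mulrC; apply: le_trans (ltW (small K)).
  rewrite ler_pM2l// /block_mass le_eqVlt; apply/orP; left; apply/eqP.
  by apply: eq_bigl => i; rewrite /tracked andbA andbb.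
apply: (@le_trans _ _ (\sum_(i < K) normc (x i) / 2 ^+ beta n)).
  rewrite [leLHS]big_mkcond; apply: ler_sum => i _; case: ifP => [/andP[/eqP i1]|_].
    rewrite /tracked i1 eqxx/= -leNgt => i2; rewrite /weight exponent_top ?i2 ?orbT//.
  by rewrite divr_ge0 ?normc_ge0// ltW.
rewrite -mulr_suml ler_pM2r ?invr_gt0//.
by apply: le_trans (nm_partial x K); rewrite big_mkord.
Qed.

Lemma block_weight_sum_trivial n K (x : l1 R) :
  \sum_(i < K | (dec i).1 == n) normc (x i) / weight (dec i).1 (dec i).2 <=
  2 ^+ n * nm x.
Proof.
apply: (@le_trans _ _ (\sum_(i < K) 2 ^+ n * normc (x i))).
  rewrite [leLHS]big_mkcond; apply: ler_sum => i _; case: ifP => [/eqP i1|_].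
    rewrite i1 mulrC ler_wpM2r ?normc_ge0// -[leRHS]invrK.
    by rewrite lef_pV2 ?posrE ?weight_gt0 ?invr_gt0 ?exprn_gt0// exprnN ler_eXz2l
      ?ltr1n// exponent_ge.
  by rewrite mulr_ge0 ?normc_ge0// exprn_ge0.
rewrite -mulr_sumr ler_pM2l ?exprn_gt0//.
by apply: le_trans (nm_partial x K); rewrite big_mkord.
Qed.

(** The finitely many blocks below [m0] get the crude bound [D1]; for the others [block_weight_sum]
    and [coef_bound_beta] give the geometric [D2]. Neither depends on [t]. *)
Lemma small_mass_bounded x m0 :
  (forall m K, (m0 <= m)%N -> 2 ^+ beta m * block_mass m K x < 1 + nm x) ->
  exists C : R, forall t, normc (iter t S x (idx 0 0)) <= C.
Proof.
move=> small.
pose D1 n : R := if (n < m0)%N then coef_bound n * (2 ^+ n * nm x) else 0.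
pose D2 n : R := (1 + 2 * nm x) * (4 * (2 ^+ n)^-1).
have x0 := nm_ge0 x.
have D20 n : 0 <= D2 n.
  by rewrite mulr_ge0 ?mulr_ge0 ?invr_ge0 ?exprn_ge0//; lra.
have D10 n : 0 <= D1 n.
  by rewrite /D1; case: ifP => // _; rewrite !mulr_ge0 ?coef_bound_ge0 ?exprn_ge0.
pose C := \sum_(0 <= n < m0) D1 n + (1 + 2 * nm x) * 8; exists C => t.
have CK K : normc (iter t S (trunc x K) (idx 0 0)) <= C.
  pose N := (\max_(i < K) (dec i).1.+1)%N.
  have iN (i : 'I_K) : ((dec i).1 < N)%N by exact: (leq_bigmax i).
  rewrite iter_trunc l1_coord_sum.
  apply: (@le_trans _ _ (\sum_(i < K)
      coef_bound (dec i).1 * (normc (x i) / weight (dec i).1 (dec i).2))).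
    elim/big_rec2 : _ => [|i c z _ zc]; first by rewrite normc0.
    apply: le_trans (le_normcD _ _) _; apply: lerD zc.
    rewrite l1_coordZ iter_ee l1_coordZ !normcM normc_real ?invr_ge0 ?(ltW (weight_gt0 _ _))//.
    rewrite mulrA mulrC ler_wpM2r//; last exact: orb_coef.
    by rewrite divr_ge0 ?normc_ge0// ltW// weight_gt0.
  pose g (i : 'I_K) : 'I_N := Ordinal (iN i).
  rewrite (partition_big g xpredT)//=.
  apply: (@le_trans _ _ (\sum_(n < N) (D1 n + D2 n))).
    apply: ler_sum => n _; rewrite (eq_bigl (fun i : 'I_K => (dec i).1 == n))//.
    rewrite (eq_bigr (fun i : 'I_K =>
      coef_bound n * (normc (x i) / weight (dec i).1 (dec i).2))); last first.
      by move=> i /eqP ->.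
    rewrite -mulr_sumr /D1; case: ltnP => nm0.
      apply: (@le_trans _ _ (coef_bound n * (2 ^+ n * nm x))); last by rewrite lerDl.
      by rewrite ler_wpM2l ?coef_bound_ge0// block_weight_sum_trivial.
    rewrite add0r /D2.
    apply: le_trans (ler_wpM2l (coef_bound_ge0 n)
      (block_weight_sum (n := n) K (fun K' => small _ K' nm0))) _.
    by rewrite mulrCA ler_wpM2l ?coef_bound_beta//; lra.
  rewrite big_split/=; apply: lerD.
    rewrite -(big_mkord xpredT D1); have [Nm|mN] := leqP N m0.
      by rewrite [leRHS](big_cat_nat _ Nm)//= lerDl sumr_ge0.
    rewrite (big_cat_nat _ (ltnW mN))//= [X in _ + X]big_nat_cond [X in _ + X]big1 ?addr0//.
    by move=> n /andP[/andP[mn _] _]; rewrite /D1 ltnNge mn.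
  rewrite -mulr_sumr -mulr_sumr ler_wpM2l//; first by lra.
  have := sum_geometric 0 N; rewrite expr0 invr1 big_mkord => h.
  rewrite (eq_bigr (fun n : 'I_N => 2 * (2 ^+ n.+1)^-1)); last first.
    by move=> n _; rewrite exprS invfM mulrA divff// mul1r.
  by rewrite -mulr_sumr; lra.
apply/ler_addgt0Pr => e e0; have [K0 K0P] := iter_conv t x e0.
rewrite -(subrK (iter t S (trunc x K0)) (iter t S x)) l1_coordD addrC.
apply: le_trans (le_normcD _ _) _; rewrite lerD ?CK//.
exact: le_trans (nm_coord _ _) (K0P _ (leqnn _)).
Qed.

Lemma backward_not_frequently_hypercyclic : ~ @frequently_hypercyclic R (l1 R) S.
Proof.
case=> x xU.
have [Hm|] := pselect (forall m0, exists2 m, (m0 <= m)%N &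
     exists K, 1 + nm x <= 2 ^+ beta m * block_mass m K x).
  apply: unbounded_mass_not_frequent Hm _; apply: xU; first exact: open_nm_ball.
  by exists 0; rewrite /nm_ball/= subrr nm0.
move=> /existsNP[m0 Hm].
have [m K m0m|C CP] := @small_mass_bounded x m0.
  by rewrite ltNge; apply/negP => h; apply: Hm; exists m => //; exists K.
(* In the unit ball around [z] the coordinate (0, 0) has modulus greater than [C], so the orbit
   never enters it. *)
pose z := ((`|C| + 1)%:C%C : R[i]) *: ee (idx 0 0).
have /lower_density_gt0P[e e0 [N0 /(_ N0 (leqnn _))]] :
    (0 < lower_density R (return_set S x (nm_ball z 1%R)))%E.
  apply: xU; first exact: open_nm_ball.
  by exists z; rewrite /nm_ball/= subrr nm0.
case: (posnP #|[set n : 'I_N0.+1 | (n : nat) \in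
    return_set S x (nm_ball z 1%R)]%SET|) => [->|].
  by apply/negP; rewrite -ltNge mulr_gt0// ltr0n.
move=> /card_gt0P[t]; rewrite inE => /set_mem; rewrite /return_set /nm_ball/= => h _.
have := CP t; apply/negP; rewrite -ltNge.
have zE : z (idx 0 0) = (`|C| + 1)%:C%C by rewrite l1_coordZ eeE eqxx mulr1.
have : normc (z (idx 0 0)) <= normc (iter t S x (idx 0 0)) + nm (iter t S x - z).
  rewrite -[X in normc X](subrK (iter t S x (idx 0 0))) addrC.
  apply: le_trans (le_normcD _ _) _; rewrite lerD2l nmC.
  exact: (nm_coord (z - iter t S x)).
rewrite zE normc_real ?addr_ge0//; have := ler_norm C; lra.
Qed.

End backward.

End blocks.

(** * Choice of the targets *)

Lemma nat_int_bijection : exists idx : nat -> int -> nat, exists dec : nat -> nat * int,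
  (forall n j, dec (idx n j) = (n, j)) /\ (forall i, idx (dec i).1 (dec i).2 = i).
Proof.
have inf : infinite_set [set: nat * int].
  move=> /(finite_image fst); apply: contra_not infinite_nat.
  by apply: sub_finite_set => n _; exists (n, 0).
have /card_set_bijP[f fb] := eq_card_nat (countableP _) inf.
have [g fK gK] : bijective f by rewrite -setTT_bijective.
exists (fun n j => f (n, j)), g; split=> [n j|i]; first by rewrite fK.
by rewrite -surjective_pairing gK.
Qed.

Section targets.
Context {R : realType}.

Let code := seq ((rat * rat) * (nat * int)).

Definition target_cost (a : code) : R :=
  \sum_(p <- a) normc (@cplx R p.1) * (2 * 2 ^+ beta p.2.1).

Definition admissible l (a : code) :=
  all (fun p => p.2.1 < l)%N a && (target_cost a <= 2 ^+ l).

(* Every code is met infinitely often, and is admissible for all large l. *)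
Definition target l : seq (R[i] * (nat * int)) :=
  if (unpickle (logn 2 l.+1) : option code) is Some a then
    if admissible l a then [seq (cplx p.1, p.2) | p <- a] else [::]
  else [::].

Lemma target_lt l p : p \in target l -> (p.2.1 < l)%N.
Proof.
rewrite /target; case: unpickle => // a; case: ifP => // /andP[/allP al _].
by move=> /mapP[q qa ->]; exact: al.
Qed.

Lemma target_le l :
  \sum_(p <- target l) normc p.1 * (2 * 2 ^+ beta p.2.1) <= 2 ^+ l.
Proof.
rewrite /target; case: unpickle => [a|]; last by rewrite big_nil exprn_ge0.
by case: ifP => [/andP[_ al]|_]; rewrite ?big_nil ?exprn_ge0// big_map.
Qed.

Lemma target_all (a : code) l0 : exists2 l, (l0 <= l)%N &
  target l = [seq (cplx p.1, p.2) | p <- a].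
Proof.
(* The last two summands make every [l >= k] admissible for [a]; the odd factor [k.*2.+1] makes [l]
   large while [l.+1] keeps valuation [pickle a]. *)
pose k := (l0 + Num.bound (target_cost a) + \sum_(p <- a) p.2.1.+1)%N.
pose l := (2 ^ pickle a * k.*2.+1).-1.
have lS : l.+1 = (2 ^ pickle a * k.*2.+1)%N by rewrite prednK// muln_gt0 expn_gt0.
have kl : (k <= l)%N.
  have : (1 * k.*2.+1 <= 2 ^ pickle a * k.*2.+1)%N by rewrite leq_mul2r expn_gt0 orbT.
  by rewrite -lS; lia.
exists l; first by apply: leq_trans kl; rewrite /k -addnA leq_addr.
rewrite /target lS -[logn _ _]/(typ _) typ_odd_part pickleK.
have -> // : admissible l a.
apply/andP; split; last first.
  by apply/ltW/upper_nthrootP; apply: leq_trans kl; rewrite /k -addnA addnCA leq_addr.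
apply/allP => p pa; apply: leq_trans kl; rewrite /k.
by rewrite (perm_big _ (perm_to_rem pa))/= big_cons addnCA leq_addr.
Qed.

End targets.

Theorem theorem3p6 (R : realType) :
  exists T Tinv : {linear l1 R -> l1 R},
    [/\ continuous T, continuous Tinv, cancel T Tinv & cancel Tinv T] /\
    frequently_hypercyclic T /\ ~ frequently_hypercyclic Tinv.
Proof.
have [idx [dec [idxK decK]]] := nat_int_bijection.
have tl := @target_lt R; have tc := @target_le R.
have [|T [Tf T8]] := @block_operator R _ _ idxK target target_lt target_le 1.
  by rewrite eqxx.
have [|S [Sf S8]] := @block_operator R _ _ idxK target target_lt target_le (- 1).
  by rewrite eqxx orbT.
exists T, S; split; [split|split].
- exact: bounded_continuous T8.
- exact: bounded_continuous S8.
- exact (block_operatorK decK target_lt Tf T8 Sf S8).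
- by apply: (block_operatorK decK target_lt Sf S8 _ T8); rewrite opprK.
- exact: (forward_frequently_hypercyclic decK target_lt Tf T8 target_all).
- exact: (backward_not_frequently_hypercyclic idxK decK target_lt target_le Sf S8).
Qed.
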